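(* Let $w=62754381\in S_8$ (one-line notation). Then $P_{e,w}(q)=1+q$, and there do not exist codominant permutations $w_0,w_2\in S_8$ such that $$\operatorname{ch}(C'_w)=\operatorname{ch}(C'_{w_0})+\operatorname{ch}(C'_{w_2}).$$
   Context: **Permutations.** $S_n$ is the group of permutations of $[n]$ with identity $e$; $\ell(w)$ is the number of inversions of $w$; $\leq$ is the Bruhat order. A permutation is *codominant* if it avoids the pattern $312$. **Hecke algebra.** $H_n$ is the $\mathbb{C}(q^{1/2})$-algebra generated by $T_s$, for $s$ running over the simple transpositions $(i,i+1)$, with relations $T_s^2=(q-1)T_s+q$; $T_sT_{s'}=T_{s'}T_s$ for $s=(i,i+1)$, $s'=(j,j+1)$ with $|i-j|>1$; $T_sT_{s'}T_s=T_{s'}T_sT_{s'}$ if $|i-j|=1$. For a reduced expression $w=s_1\cdots s_{\ell(w)}$, $T_w=T_{s_1}\cdots T_{s_{\ell(w)}}$; the $T_w$ form a basis. Let $\iota$ be the ring involution of $H_n$ with $q^{1/2}\mapsto q^{-1/2}$, $T_w\mapsto T_{w^{-1}}^{-1}$. The Kazhdan-Lusztig basis $\{C'_w\}$ and the Kazhdan-Lusztig polynomials $P_{z,w}$ are determined by $\iota(C'_w)=C'_w$ and $q^{\ell(w)/2}C'_w=\sum_{z\leq w}P_{z,w}(q)T_z$, where $P_{z,w}\in\mathbb{Z}[q]$, $P_{w,w}=1$ and $\deg P_{z,w}<\frac{\ell(w)-\ell(z)}{2}$ for $z\neq w$. **Characters.** For a partition $\lambda\vdash n$, $\chi^\lambda$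 denotes the irreducible character of $H_n$ that specializes at $q=1$ to the irreducible character of $S_n$ indexed by $\lambda$. For $a\in H_n$, $\operatorname{ch}(a)=\sum_{\lambda\vdash n}\chi^\lambda(a)s_\lambda(x)\in\mathbb{C}(q^{1/2})\otimes\Lambda$, where $\Lambda$ is the algebra of symmetric functions and $s_\lambda$ are Schur functions. *)

(* Defs.v *)
From HB Require Import structures.
From mathcomp Require Import all_boot all_order all_algebra all_fingroup.
From mathcomp Require Import mxrepresentation fraction generic_quotient boolp.
From mathcomp Require Import reals complex.
From mathcomp Require Import mpoly.
Set Implicit Arguments.
Unset Strict Implicit.
Unset Printing Implicit Defensive.
Import GRing.Theory.
Local Open Scope ring_scope.

(* Permutations act on {0, ..., n-1} instead of {1, ..., n}.  MathComp's
   product on 'S_n is (s * t) x = t (s x), the reverse of the usual composition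
   of functions; word_perm is written so that it composes functions from right
   to left: word_perm [:: i; j] x = s_i (s_j x). *)

Definition simple_transp n (i : 'I_n.-1) : 'S_n :=
  tperm (widen_ord (leq_pred n) i)
        (Ordinal (etrans (esym (ltn_predRL i n)) (ltn_ord i))).

Definition word_perm n (s : seq 'I_n.-1) : 'S_n :=
  foldr (fun i u => u * simple_transp i)%g 1%g s.

Definition ell n (w : 'S_n) : nat :=
  #|[set p : 'I_n * 'I_n | (p.1 < p.2)%N && (w p.2 < w p.1)%N]|.

Definition bruhat_step n (u v : 'S_n) : bool :=
  [exists i, exists j, v == (tperm i j * u)%g] && (ell u < ell v)%N.

Definition bruhat n (u v : 'S_n) : bool := connect (@bruhat_step n) u v.

Definition codominant n (w : 'S_n) : bool :=
  [forall i : 'I_n, forall j : 'I_n, forall k : 'I_n,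
     ~~ [&& (i < j)%N, (j < k)%N, (w j < w k)%N & (w k < w i)%N]].

Definition one_line n (w : 'S_n) : seq nat := [seq (w i).+1 | i <- enum 'I_n].

(* F(v), where v stands for q^(1/2). *)
Definition ratfun (F : fieldType) : fieldType := {fraction {poly F}}.

Definition vpar (F : fieldType) : ratfun F := tofrac 'X.
Definition qpar (F : fieldType) : ratfun F := vpar F ^+ 2.

(* The algebra given by generators and relations is the quotient of formal
   expressions by the congruence generated by the axioms of associative unital
   F(v)-algebras and by the Hecke relations. *)
Inductive hterm (F : fieldType) (n : nat) : Type :=
| HScal of ratfun F
| HGen of 'I_n.-1
| HAdd of hterm F n & hterm F n
| HMul of hterm F n & hterm F n.

Arguments HScal {F n}.
Arguments HGen {F n}.

Inductive heq (F : fieldType) (n : nat) : hterm F n -> hterm F n -> Prop :=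
| heq_refl x : heq x x
| heq_sym x y : heq x y -> heq y x
| heq_trans x y z : heq x y -> heq y z -> heq x z
| heq_addc x x' y y' : heq x x' -> heq y y' -> heq (HAdd x y) (HAdd x' y')
| heq_mulc x x' y y' : heq x x' -> heq y y' -> heq (HMul x y) (HMul x' y')
| heq_addA x y z : heq (HAdd x (HAdd y z)) (HAdd (HAdd x y) z)
| heq_addC x y : heq (HAdd x y) (HAdd y x)
| heq_add0 x : heq (HAdd (HScal 0) x) x
| heq_addN x : heq (HAdd (HMul (HScal (-1)) x) x) (HScal 0)
| heq_mulA x y z : heq (HMul x (HMul y z)) (HMul (HMul x y) z)
| heq_mul1 x : heq (HMul (HScal 1) x) x
| heq_mulDl x y z : heq (HMul (HAdd x y) z) (HAdd (HMul x z) (HMul y z))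
| heq_mulDr x y z : heq (HMul x (HAdd y z)) (HAdd (HMul x y) (HMul x z))
| heq_scalD a b : heq (HScal (a + b)) (HAdd (HScal a) (HScal b))
| heq_scalM a b : heq (HScal (a * b)) (HMul (HScal a) (HScal b))
| heq_scalC a x : heq (HMul (HScal a) x) (HMul x (HScal a))
| heq_quad i :
    heq (HMul (HGen i) (HGen i))
        (HAdd (HMul (HScal (qpar F - 1)) (HGen i)) (HScal (qpar F)))
| heq_comm (i j : 'I_n.-1) : (1 < `|i%:Z - j%:Z|)%N ->
    heq (HMul (HGen i) (HGen j)) (HMul (HGen j) (HGen i))
| heq_braid (i j : 'I_n.-1) : `|i%:Z - j%:Z|%N = 1%N ->
    heq (HMul (HMul (HGen i) (HGen j)) (HGen i))
        (HMul (HMul (HGen j) (HGen i)) (HGen j)).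

HB.instance Definition _ F n := gen_eqMixin (hterm F n).
HB.instance Definition _ F n := gen_choiceMixin (hterm F n).

Definition heqb F n (x y : hterm F n) : bool := `[< heq x y >].

Lemma heqb_refl F n : reflexive (@heqb F n).
Proof. by move=> x; apply/asboolP; apply: heq_refl. Qed.

Lemma heqb_sym F n : ssrbool.symmetric (@heqb F n).
Proof. by move=> x y; apply/asboolP/asboolP; apply: heq_sym. Qed.

Lemma heqb_trans F n : transitive (@heqb F n).
Proof.
move=> y x z /asboolP xy /asboolP yz; apply/asboolP; exact: heq_trans xy yz.
Qed.

Canonical heqb_equiv F n : equiv_rel (hterm F n) :=
  EquivRel (@heqb F n) (@heqb_refl F n) (@heqb_sym F n) (@heqb_trans F n).

Definition hecke (F : fieldType) (n : nat) : Type :=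
  {eq_quot (heqb_equiv F n)}%qT.

HB.instance Definition _ F n := Choice.on (hecke F n).

Section HeckeAlgebra.
Variables (F : fieldType) (n : nat).
Local Notation H := (hecke F n).

Definition hcls (x : hterm F n) : H := (\pi_{eq_quot (heqb_equiv F n)} x)%qT.
Definition hrepr (x : H) : hterm F n := repr (x : {eq_quot (heqb_equiv F n)}%qT).

Lemma hclsK x : hcls (hrepr x) = x.
Proof. exact: reprK. Qed.

Lemma hclsP x y : hcls x = hcls y <-> heq x y.
Proof.
split=> [/eqmodP/asboolP //|xy]; apply/eqmodP; exact/asboolP.
Qed.

Lemma hclsE x : heq (hrepr (hcls x)) x.
Proof. by apply/hclsP; rewrite hclsK. Qed.

Lemma hecke_ind (P : H -> Prop) : (forall x, P (hcls x)) -> forall x, P x.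
Proof. by move=> Px x; rewrite -[x]hclsK. Qed.

Definition hscal (a : ratfun F) : H := hcls (HScal a).
Definition hadd (x y : H) : H := hcls (HAdd (hrepr x) (hrepr y)).
Definition hmul (x y : H) : H := hcls (HMul (hrepr x) (hrepr y)).
Definition hopp (x : H) : H := hmul (hscal (-1)) x.
Definition hscale (a : ratfun F) (x : H) : H := hmul (hscal a) x.

Lemma haddE x y : hadd (hcls x) (hcls y) = hcls (HAdd x y).
Proof. by apply/hclsP/heq_addc; apply: hclsE. Qed.

Lemma hmulE x y : hmul (hcls x) (hcls y) = hcls (HMul x y).
Proof. by apply/hclsP/heq_mulc; apply: hclsE. Qed.

Lemma haddA : associative hadd.
Proof.
do 3!elim/hecke_ind=> ?; rewrite !haddE; apply/hclsP; exact: heq_addA.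
Qed.

Lemma haddC : commutative hadd.
Proof. do 2!elim/hecke_ind=> ?; rewrite !haddE; apply/hclsP; exact: heq_addC. Qed.

Lemma hadd0 : left_id (hscal 0) hadd.
Proof. elim/hecke_ind=> ?; rewrite haddE; apply/hclsP; exact: heq_add0. Qed.

Lemma haddN : left_inverse (hscal 0) hopp hadd.
Proof.
elim/hecke_ind=> ?; rewrite /hopp hmulE haddE; apply/hclsP; exact: heq_addN.
Qed.

Lemma hmulA : associative hmul.
Proof.
do 3!elim/hecke_ind=> ?; rewrite !hmulE; apply/hclsP; exact: heq_mulA.
Qed.

Lemma hscalC a x : hmul (hscal a) x = hmul x (hscal a).
Proof.
elim/hecke_ind: x => ?; rewrite !hmulE; apply/hclsP; exact: heq_scalC.
Qed.

Lemma hmul1 : left_id (hscal 1) hmul.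
Proof. elim/hecke_ind=> ?; rewrite hmulE; apply/hclsP; exact: heq_mul1. Qed.

Lemma hmulr1 : right_id (hscal 1) hmul.
Proof. by move=> x; rewrite -hscalC hmul1. Qed.

Lemma hmulDl : left_distributive hmul hadd.
Proof.
do 3!elim/hecke_ind=> ?; rewrite !(haddE, hmulE); apply/hclsP; exact: heq_mulDl.
Qed.

Lemma hmulDr : right_distributive hmul hadd.
Proof.
do 3!elim/hecke_ind=> ?; rewrite !(haddE, hmulE); apply/hclsP; exact: heq_mulDr.
Qed.

Lemma hscalD a b : hscal (a + b) = hadd (hscal a) (hscal b).
Proof. rewrite haddE; apply/hclsP; exact: heq_scalD. Qed.

Lemma hscalM a b : hscal (a * b) = hmul (hscal a) (hscal b).
Proof. rewrite hmulE; apply/hclsP; exact: heq_scalM. Qed.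

(* The character T_s |-> q, which shows that the algebra is nonzero. *)
Fixpoint hindex (x : hterm F n) : ratfun F :=
  match x with
  | HScal a => a
  | HGen _ => qpar F
  | HAdd x y => hindex x + hindex y
  | HMul x y => hindex x * hindex y
  end.

Lemma hindexP x y : heq x y -> hindex x = hindex y.
Proof.
elim=> //= {x y}.
- by move=> x y z _ -> _ ->.
- by move=> x x' y y' _ -> _ ->.
- by move=> x x' y y' _ -> _ ->.
- by move=> x y z; rewrite addrA.
- by move=> x y; rewrite addrC.
- by move=> x; rewrite add0r.
- by move=> x; rewrite mulN1r addNr.
- by move=> x y z; rewrite mulrA.
- by move=> x; rewrite mul1r.
- by move=> x y z; rewrite mulrDl.
- by move=> x y z; rewrite mulrDr.
- by move=> a x; rewrite mulrC.
- by move=> _; rewrite mulrBl mul1r subrK.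
Qed.

Lemma hone_neq0 : hscal 1 != hscal 0.
Proof.
by apply/eqP => /hclsP/hindexP/= /eqP; rewrite oner_eq0.
Qed.

HB.instance Definition _ :=
  GRing.isNzRing.Build H haddA haddC hadd0 haddN
    hmulA hmul1 hmulr1 hmulDl hmulDr hone_neq0.

Lemma hscaleA a b x : hscale a (hscale b x) = hscale (a * b) x.
Proof. by rewrite /hscale hscalM hmulA. Qed.

Lemma hscale1 : left_id 1 hscale.
Proof. exact: hmul1. Qed.

Lemma hscaleDr : right_distributive hscale +%R.
Proof. move=> a x y; exact: hmulDr. Qed.

Lemma hscaleDl x : {morph hscale^~ x : a b / a + b}.
Proof. by move=> a b; rewrite /hscale hscalD hmulDl. Qed.

HB.instance Definition _ :=
  GRing.Zmodule_isLmodule.Build (ratfun F) H hscaleA hscale1 hscaleDr hscaleDl.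

Lemma hscaleAl (a : ratfun F) (x y : H) : a *: (x * y) = a *: x * y.
Proof. exact: hmulA. Qed.

HB.instance Definition _ :=
  GRing.Lmodule_isLalgebra.Build (ratfun F) H hscaleAl.

Lemma hscaleAr (a : ratfun F) (x y : H) : a *: (x * y) = x * (a *: y).
Proof.
by rewrite scalerAl; change (hmul (hmul (hscal a) x) y = hmul x (hmul (hscal a) y));
   rewrite hscalC hmulA.
Qed.

HB.instance Definition _ :=
  GRing.Lalgebra_isAlgebra.Build (ratfun F) H hscaleAr.

Definition T_gen (i : 'I_n.-1) : H := hcls (HGen i).

(* There always is a reduced expression, so the default value 0 is not used; by
   Matsumoto's theorem the choice of the reduced expression is immaterial. *)
Definition T_ (w : 'S_n) : H :=
  if [pick s : (ell w).-tuple 'I_n.-1 | word_perm s == w] is Some s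
  then \prod_(i <- s) T_gen i else 0.

End HeckeAlgebra.

(* As a map over F(v), iota is only semilinear: it fixes F and inverts v. *)
Definition bar_involution F n (iota : {rmorphism hecke F n -> hecke F n}) : Prop :=
  [/\ involutive iota,
      forall c : F, iota (tofrac c%:P : ratfun F)%:A = (tofrac c%:P : ratfun F)%:A,
      iota (vpar F)%:A = ((vpar F)^-1)%:A
    & forall w : 'S_n, iota (T_ F w) * T_ F w^-1 = 1 /\
                       T_ F w^-1 * iota (T_ F w) = 1].

Definition eval_q (F : fieldType) (p : {poly int}) : ratfun F :=
  (map_poly intr p).[qpar F].

(* The strict bound 2 deg P_(z,w) < l(w) - l(z) also covers P_(z,w) = 0, as
   l(z) < l(w) there. *)
Definition KL_basis F n (iota : {rmorphism hecke F n -> hecke F n})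
    (C' : 'S_n -> hecke F n) (P : 'S_n -> 'S_n -> {poly int}) : Prop :=
  forall w : 'S_n,
  [/\ iota (C' w) = C' w,
      vpar F ^+ ell w *: C' w =
        \sum_(z | bruhat z w) eval_q F (P z w) *: T_ F z,
      P w w = 1
    & forall z, bruhat z w -> z != w ->
        (2 * (size (P z w)).-1 < ell w - ell z)%N].

(* A partition of n has at most n parts, each at most n; it is padded with
   zeros to length n. *)
Definition is_intpart n (t : n.-tuple 'I_n.+1) : bool :=
  sorted geq (map val t) && (sumn (map val t) == n).

Definition intpart n := {t : n.-tuple 'I_n.+1 | is_intpart t}.

Definition parts n (l : intpart n) : seq nat := map val (val l).

Definition cell n (l : intpart n) :=
  {c : 'I_n * 'I_n | (c.2 < nth 0 (parts l) c.1)%N}.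

Definition cell_row n (l : intpart n) (c : cell l) : nat := (val c).1.
Definition cell_col n (l : intpart n) (c : cell l) : nat := (val c).2.

Definition is_ssyt n (l : intpart n) m (t : {ffun cell l -> 'I_m}) : bool :=
  [forall a, forall b,
     ([&& cell_row a == cell_row b & (cell_col a < cell_col b)%N]
        ==> (t a <= t b)%N)
  && ([&& cell_col a == cell_col b & (cell_row a < cell_row b)%N]
        ==> (t a < t b)%N)].

(* A symmetric function over K is represented by the family, for all m, of its
   specializations to m variables. *)
Definition symfun (K : fieldType) := forall m : nat, {mpoly K[m]}.

Definition schur (K : fieldType) n (l : intpart n) : symfun K := fun m =>
  \sum_(t : {ffun cell l -> 'I_m} | is_ssyt t) \prod_(c : cell l) 'X_(t c).

(* The tableau of shape l filled row by row with 0, ..., n-1. *)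
Definition row_of n (l : intpart n) (i : 'I_n) : nat := reshape_index (parts l) i.
Definition col_of n (l : intpart n) (i : 'I_n) : nat := reshape_offset (parts l) i.

Definition row_stab n (l : intpart n) : {set 'S_n} :=
  [set g : 'S_n | [forall i, row_of l (g i) == row_of l i]].
Definition col_stab n (l : intpart n) : {set 'S_n} :=
  [set g : 'S_n | [forall i, col_of l (g i) == col_of l i]].

(* gring_row sends the matrix of g in the regular representation to the basis
   vector indexed by g. *)
Definition young_symmetrizer (F : fieldType) n (l : intpart n) :
    'rV[F]_#|[set: 'S_n]%G| :=
  \sum_(g in row_stab l) \sum_(h in col_stab l)
     (-1) ^+ odd_perm h *: gring_row (regular_repr F [set: 'S_n]%G (g * h)%g).

(* The character of the submodule of the regular module generated by the Young
   symmetrizer of l.  This is a right ideal, which for the reversed product of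
   MathComp is the usual left ideal. *)
Definition Sn_char (F : fieldType) n (l : intpart n) (w : 'S_n) : F :=
  \tr (submod_repr
         (cyclic_mx_module (regular_repr F [set: 'S_n]%G)
                           (young_symmetrizer F l)) w).

Definition irreducible_rep (F : fieldType) n d
    (rho : {lrmorphism hecke F n -> 'M[ratfun F]_d.+1}) : Prop :=
  forall U : 'M[ratfun F]_d.+1,
    (forall a, stablemx U (rho a)) -> U != 0 -> row_full U.

(* f is regular at v = q^(1/2) = 1, with value c. *)
Definition specializes (F : fieldType) (f : ratfun F) (c : F) : Prop :=
  exists p r : {poly F},
    [/\ r.[1] != 0, f = tofrac p / tofrac r & c = p.[1] / r.[1]].

Definition hecke_char (F : fieldType) n (l : intpart n)
    (chi : hecke F n -> ratfun F) : Prop :=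
  (exists (d : nat) (rho : {lrmorphism hecke F n -> 'M[ratfun F]_d.+1}),
     irreducible_rep rho /\ forall a, chi a = \tr (rho a))
  /\ (forall w : 'S_n, specializes (chi (T_ F w)) (Sn_char F l w)).

Definition ch (F : fieldType) n (chi : intpart n -> hecke F n -> ratfun F)
    (a : hecke F n) : symfun (ratfun F) :=
  fun m => \sum_(l : intpart n) chi l a *: schur (ratfun F) l m.

(* Main.v *)
Require Import Defs.
From HB Require Import structures.
From Stdlib Require BinNat Nnat.
From mathcomp Require Import all_boot all_order all_algebra all_fingroup.
From mathcomp Require Import mxrepresentation fraction generic_quotient boolp.
From mathcomp Require Import reals complex.
From mathcomp Require Import mpoly.
From mathcomp Require Import zify ring.
Import GRing.Theory.
Local Open Scope ring_scope.

Set Implicit Arguments.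
Unset Strict Implicit.
Unset Printing Implicit Defensive.

(** Write v for q^(1/2), s for the transposition of the first two positions and
w1 = 26754381, so that w = w1 s.

The Kazhdan-Lusztig elements that matter are explicit.  For a function h on
positions let D_h be the sum of the T_z over the permutations z with
z(a) < h(a) for all a, positions and values being counted from 0.  The modular
law D_(h1) (1 + T_i) = D_h + q D_(h0) of [below_sum_modular] expresses D_h by
two sums with smaller h, so an induction on the sum of h shows that the bar
involution multiplies D_h by a power of q ([bar_below_sum]).  A codominant
permutation u is the unique longest element among the z bounded by its running
maxima h_u ([ell_below_codominant]).  Hence D_(h_u) has all the properties that
characterize v^l(u) C'_u, and it is equal to it ([KL_codominant]): Bruhat
intervals need not be computed.  The permutation w1 is codominant, and the z
bounded by h_(w1) that have a descent at the first position are short enough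
for D_(h_(w1)) (1 + T_s) to satisfy the degree bounds for w
([KL_codominant_mul_simple]).  So v^17 C'_w = D_(h_(w1)) (1 + T_s), and its
coefficient at T_e is 1 + q.  That the properties do characterize the basis
([KL_basis_unique]) rests on the linear independence of the T_z, which is seen
on the right regular module of functions on the symmetric group.

Suppose that ch(C'_w) = ch(C'_(w0)) + ch(C'_(w2)).  In one variable only the
Schur polynomial of the partition (8) survives, and then the coefficient of
x0^7 x1 in two variables isolates (7,1); so the values of chi^(8) and of
chi^(7,1) satisfy the same relation ([schur_coef_row], [schur_coef_hook]).  At
q = 1 the character chi^(8) is trivial and chi^(8) + chi^(7,1) counts fixed
points.  If N(u) is the number of permutations bounded by h_u and F(u) the
number of their fixed points altogether, this gives

    N(w0) + N(w2) = 4800   and   F(w0) + F(w2) = 8832.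

These two equations do not suffice: w0 = w2 = w1, of length 16, satisfies them.
But chi^(8) maps T_z to q^l(z) also for generic q ([index_char]), and a
comparison of the terms of lowest degree in v shows that w0 or w2 has length 17
([ell_eq_17]).  Both N(u) and F(u) are given by products of differences of the
running maxima ([card_below_place]), and a search through all the possible
running maxima finds no u of length 17 that has a partner
([no_pair_of_bounds]). *)

(** * Lengths, descents and reduced words *)

Section Descents.
Variable n : nat.
Implicit Types (i j : 'I_n.-1) (w z : 'S_n).
Local Notation t_ := (@simple_transp n).

Definition lo i : 'I_n := widen_ord (leq_pred n) i.
Definition hi i : 'I_n := Ordinal (etrans (esym (ltn_predRL i n)) (ltn_ord i)).

Lemma simple_transpE i : t_ i = tperm (lo i) (hi i). Proof. by []. Qed.

Lemma lo_neq_hi i : lo i != hi i.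
Proof. by rewrite -val_eqE /= neq_ltn ltnSn. Qed.

(** A right descent: the composite w s_i of functions, which exchanges the
values of w at positions i and i+1, is the product s_i * w here. *)
Definition descent i w : bool := (w (hi i) < w (lo i))%N.

Lemma simple_transpK i : involutive (fun w => t_ i * w)%g.
Proof. by move=> w; rewrite mulgA tperm2 mul1g. Qed.

Lemma descentM i w : descent i (t_ i * w)%g = ~~ descent i w.
Proof.
rewrite /descent !permM tpermL tpermR -leqNgt ltn_neqAle.
by rewrite (inj_eq (@ord_inj n)) (inj_eq perm_inj) lo_neq_hi.
Qed.

Lemma transp_mono i (a b : 'I_n) :
  (a < b)%N -> (a, b) != (lo i, hi i) -> (t_ i a < t_ i b)%N.
Proof.
rewrite xpair_eqE -!val_eqE /= => ab ne.
have tE (c : 'I_n) : t_ i c =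
    (if c == i :> nat then i.+1 else if c == i.+1 :> nat then i : nat else c) :> nat.
  by rewrite simple_transpE permE /= -!val_eqE /=; case: ifP => // _; case: ifP.
by rewrite !tE; do 4?[case: eqP => ?]; lia.
Qed.

Definition inv_set w := [set p : 'I_n * 'I_n | (p.1 < p.2)%N && (w p.2 < w p.1)%N].

(** The transposition s_i preserves the order of all pairs of positions except
that of (i, i+1), hence it carries inversions of w to inversions of w s_i and
creates a single one. *)
Lemma inv_set_ascent i w : ~~ descent i w ->
  inv_set (t_ i * w)%g
    = (lo i, hi i) |: [set (t_ i p.1, t_ i p.2) | p in inv_set w].
Proof.
move=> asc; apply/setP=> -[a b]; rewrite !inE /= xpair_eqE.
apply/idP/idP.
- case: (boolP ((a, b) == (lo i, hi i))) => [|ne]; first by rewrite xpair_eqE => ->.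
  rewrite !permM => /andP[ab inv]; apply/orP; right.
  apply/imsetP; exists (t_ i a, t_ i b); last by rewrite /= !tpermK.
  by rewrite inE /= transp_mono.
- case/orP=> [/andP[/eqP-> /eqP->]|].
    by rewrite -/(descent i _) descentM asc /= ltnSn.
  case/imsetP=> -[c d]; rewrite inE /= => /andP[cd inv] [-> ->].
  rewrite !permM !tpermK inv andbT; apply: transp_mono => //.
  by apply: contraNneq asc => -[ec ed]; rewrite /descent -ec -ed.
Qed.

Lemma ell_ascent i w : ~~ descent i w -> ell (t_ i * w)%g = (ell w).+1.
Proof.
move=> asc; rewrite /ell -!/(inv_set _) inv_set_ascent // cardsU1.
rewrite card_imset; last first.
  by move=> [a b] [c d] /= [/perm_inj-> /perm_inj->].
suff -> : (lo i, hi i) \notin [set (t_ i p.1, t_ i p.2) | p in inv_set w] by [].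
apply/imsetP=> -[[a b]]; rewrite inE /= => /andP[ab _] [/esym ea /esym eb].
move: ab; rewrite -[a](tpermK (lo i) (hi i)) -[b](tpermK (lo i) (hi i)) ea eb.
by rewrite tpermL tpermR /= ltnNge leqnSn.
Qed.

Lemma ell_descent i w : descent i w -> ell w = (ell (t_ i * w)%g).+1.
Proof.
by move=> des; rewrite -{1}[w](simple_transpK i) ell_ascent // descentM des.
Qed.

Lemma ell_leS i w : (ell (t_ i * w)%g <= (ell w).+1)%N.
Proof.
by case: (boolP (descent i w)) => [/ell_descent->|/ell_ascent->]; lia.
Qed.

Lemma ell1 : ell (1 : 'S_n) = 0%N.
Proof.
apply/eqP; rewrite cards_eq0; apply/eqP/setP=> p; rewrite !inE !perm1.
by apply/negP=> /andP[/ltn_trans lt /lt]; rewrite ltnn.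
Qed.

(** The differences a - w(a) are nonnegative and add up to 0. *)
Lemma perm_le_id w : (forall a : 'I_n, (w a <= a)%N) -> w = 1%g.
Proof.
move=> le_id; have : (\sum_(a : 'I_n) (a - w a) = 0)%N.
  rewrite sumnB //.
  by rewrite [X in (X - _)%N](reindex_inj (@perm_inj _ w)) /= subnn.
move/eqP; rewrite sum_nat_eq0 => /forallP eq_id.
apply/permP=> a; apply/val_inj; rewrite perm1 /=.
by have := le_id a; have := eq_id a; rewrite /=; lia.
Qed.

Lemma no_descent_perm1 w : (forall i, ~~ descent i w) -> w = 1%g.
Proof.
move=> asc; have ge_id (i : 'I_n) : (i <= w i)%N.
  have [m mi] : exists m, m = nat_of_ord i by exists (nat_of_ord i).
  elim: m i mi => [|m IH] i mi; first by rewrite -mi.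
  have mn : (m < n.-1)%N by have := ltn_ord i; lia.
  have := IH (lo (Ordinal mn)) erefl; have := asc (Ordinal mn).
  have -> : i = hi (Ordinal mn) by apply/val_inj.
  rewrite /descent -leqNgt leq_eqVlt (inj_eq (@ord_inj n)) (inj_eq perm_inj).
  rewrite (negPf (lo_neq_hi _)) /=; lia.
apply: (can_inj (@invgK _)); rewrite invg1; apply: perm_le_id => i.
by have := ge_id (w^-1%g i); rewrite permKV.
Qed.

(** Words are read from left to right as products of functions, which makes
appending a letter a multiplication on the right. *)
Lemma word_perm_rcons s i : word_perm (rcons s i) = (t_ i * word_perm s)%g.
Proof.
rewrite /word_perm -cats1 foldr_cat /= mul1g.
elim: s => [|j s IH] /=; first by rewrite mulg1.
by rewrite IH mulgA.
Qed.

Lemma ell_word_perm s : (ell (@word_perm n s) <= size s)%N.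
Proof.
elim/last_ind: s => [|s i IH]; first by rewrite ell1.
by rewrite word_perm_rcons size_rcons (leq_trans (ell_leS _ _)).
Qed.

Definition reduced (s : seq 'I_n.-1) : bool := size s == ell (word_perm s).

Lemma reduced_rcons s i :
  reduced (rcons s i) = reduced s && ~~ descent i (word_perm s).
Proof.
rewrite /reduced word_perm_rcons size_rcons.
case: (boolP (descent i _)) => [/ell_descent|/ell_ascent ->]; last by rewrite andbT.
by have := ell_word_perm s; rewrite andbF; lia.
Qed.

Lemma reduced_word_ex w : exists2 s, reduced s & word_perm s = w.
Proof.
have [k] : exists k, k = ell w by exists (ell w).
elim: k w => [|k IH] w kw.
  exists [::]; first by rewrite /reduced /= ell1.
  symmetry; apply: no_descent_perm1 => i; apply/negP=> /ell_descent; lia.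
case: (pickP (fun i => descent i w)) => [i des|asc].
  have [|s red sw] := IH (t_ i * w)%g; first by have := ell_descent des; lia.
  exists (rcons s i); last by rewrite word_perm_rcons sw simple_transpK.
  by rewrite reduced_rcons red sw descentM des.
by move: kw; rewrite [w]no_descent_perm1 ?ell1 // => i; rewrite asc.
Qed.

End Descents.

(** * The standard basis of the Hecke algebra *)

Section StandardBasis.
Variables (F : fieldType) (n : nat).
Implicit Types (i j : 'I_n.-1) (w z : 'S_n) (s : seq 'I_n.-1).
Local Notation t_ := (@simple_transp n).
Local Notation H := (hecke F n).
Local Notation K := (ratfun F).
Local Notation q := (qpar F).
Local Notation Tg := (@T_gen F n).
Local Notation T := (@T_ F n).

Lemma hclsM (x y : hterm F n) : hcls x * hcls y = hcls (HMul x y).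
Proof. exact: hmulE. Qed.

Lemma hclsD (x y : hterm F n) : hcls x + hcls y = hcls (HAdd x y).
Proof. exact: haddE. Qed.

Lemma hclsZ a (x : hterm F n) : a *: hcls x = hcls (HMul (HScal a) x).
Proof. exact: hmulE. Qed.

Lemma T_gen_sq i : Tg i * Tg i = (q - 1) *: Tg i + q%:A.
Proof.
rewrite [q%:A](hmulr1 (hscal n q)) /T_gen /hscal hclsM hclsZ hclsD.
by apply/hclsP/heq_quad.
Qed.

Lemma T_gen_comm i j : (1 < `|i%:Z - j%:Z|)%N -> Tg i * Tg j = Tg j * Tg i.
Proof. by move=> far; rewrite /T_gen !hclsM; apply/hclsP/heq_comm. Qed.

Lemma T_gen_braid i j : `|i%:Z - j%:Z|%N = 1%N ->
  Tg i * Tg j * Tg i = Tg j * Tg i * Tg j.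
Proof. by move=> adj; rewrite /T_gen !hclsM; apply/hclsP/heq_braid. Qed.

Definition T_word s : H := \prod_(i <- s) Tg i.

Lemma T_word_rcons s i : T_word (rcons s i) = T_word s * Tg i.
Proof. by rewrite /T_word -cats1 big_cat big_seq1. Qed.

Lemma simple_transp_comm i j : (1 < `|i%:Z - j%:Z|)%N ->
  (t_ i * t_ j = t_ j * t_ i)%g.
Proof.
move=> far; apply/commgP/conjg_fixP; rewrite tpermJ.
by rewrite !tpermD // -val_eqE /=; lia.
Qed.

Lemma descent_far i j w : (1 < `|i%:Z - j%:Z|)%N ->
  descent i (t_ j * w)%g = descent i w.
Proof. by move=> far; rewrite /descent !permM !tpermD // -val_eqE /=; lia. Qed.

(** Let w take the values x, y, z at the three positions moved by s_i and s_j.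
All descents met along the six permutations of these values are given by the
three comparisons of x, y and z; the outer one is the boolean c, and
transitivity relates it to the other two. *)
Lemma descent_adj i j w : `|i%:Z - j%:Z|%N = 1%N -> exists c : bool,
  [/\ descent j (t_ i * w)%g = c /\ descent i (t_ j * w)%g = c,
      descent i (t_ j * (t_ i * w))%g = descent j w,
      descent j (t_ i * (t_ j * w))%g = descent i w,
      descent i w -> descent j w -> c
    & ~~ descent i w -> ~~ descent j w -> ~~ c].
Proof.
wlog ij : i j / j = i.+1 :> nat => [gen adj|_].
  have [ij|ji] : j = i.+1 :> nat \/ i = j.+1 :> nat by lia.
    exact: gen.
  have [|c [[ci cj] ei ej dd aa]] := gen j i ji; first by rewrite distnC.
  by exists c; split=> // hi hj; [apply: dd | apply: aa].
have lj : lo j = hi i by apply/val_inj.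
have ti : t_ i (hi j) = hi j by rewrite tpermD // -val_eqE /=; lia.
have tj : t_ j (lo i) = lo i by rewrite tpermD // -val_eqE /=; lia.
have tL k : t_ k (lo k) = hi k by rewrite tpermL.
have tR k : t_ k (hi k) = lo k by rewrite tpermR.
have tLj : t_ j (hi i) = hi j by rewrite -lj tL.
exists (w (hi j) < w (lo i))%N; rewrite /descent !permM.
by split; rewrite ?lj ?tLj ?tR ?lj ?tj ?ti ?tL ?tR ?ti ?tL ?lj //; lia.
Qed.

Lemma simple_transp_braid i j : `|i%:Z - j%:Z|%N = 1%N ->
  (t_ i * t_ j * t_ i = t_ j * t_ i * t_ j)%g.
Proof.
wlog ij : i j / j = i.+1 :> nat => [gen adj|_].
  have [ij|ji] : j = i.+1 :> nat \/ i = j.+1 :> nat by lia.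
    exact: gen.
  by symmetry; apply: gen => //; lia.
have lj : lo j = hi i by apply/val_inj.
have conjE (a b : 'I_n.-1) : (t_ a * t_ b * t_ a = t_ b ^ t_ a)%g.
  by rewrite conjgE tpermV mulgA.
rewrite !conjE !simple_transpE !tpermJ lj tpermR tpermL.
by rewrite !tpermD // -val_eqE /=; lia.
Qed.

(** Matsumoto's theorem, by induction on the length.  If two reduced words of w
end in different letters i and j, then w has both descents, so w also has
reduced words that end in i j and in j i when s_i and s_j commute, and in i j i
and in j i j otherwise.  The induction hypothesis leads from the given words to
these, which are related by a defining relation. *)
Lemma T_word_reduced s t : reduced s -> reduced t ->
  word_perm s = word_perm t -> T_word s = T_word t.
Proof.
have [k] : exists k, size s = k by exists (size s).
elim: k s t => [|k IH] s t.
  by move=> /size0nil -> _ /eqP + e; rewrite -e /= ell1 => /size0nil ->.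
case/lastP: s => // s i; rewrite size_rcons => -[sk].
case/lastP: t => [/eqP + _ e|t j red_s red_t]; first by rewrite e /= ell1 size_rcons.
rewrite !word_perm_rcons => e.
have tk : size t = k.
  by have := eqP red_s; have := eqP red_t; rewrite !word_perm_rcons e !size_rcons sk; lia.
move: (red_s) (red_t); rewrite !reduced_rcons => /andP[red_s' asc_i] /andP[red_t' asc_j].
rewrite !T_word_rcons.
have [eij|nij] := eqVneq i j.
  by subst j; rewrite (IH s t) //; move/mulgI: e.
have [w w_s] : exists w, w = (t_ i * word_perm s)%g by exists (t_ i * word_perm s)%g.
rewrite -w_s in e; have des_i : descent i w by rewrite w_s descentM.
have des_j : descent j w by rewrite e descentM.
have ws : word_perm s = (t_ i * w)%g by rewrite w_s simple_transpK.
have wt : word_perm t = (t_ j * w)%g by rewrite e simple_transpK.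
have [far|adj] : (1 < `|i%:Z - j%:Z|)%N \/ `|i%:Z - j%:Z|%N = 1%N.
- by move: nij; rewrite -val_eqE /=; lia.
- have [r red_r wr] := reduced_word_ex (t_ i * (t_ j * w))%g.
  have des_ij : descent i (t_ j * w)%g by rewrite descent_far.
  have des_ji : descent j (t_ i * w)%g by rewrite descent_far // distnC.
  have es : T_word s = T_word (rcons r j).
    apply: IH; rewrite ?reduced_rcons ?word_perm_rcons ?wr ?red_r ?ws //.
      by rewrite mulgA simple_transp_comm // -mulgA descentM des_ji.
    by rewrite !mulgA -(simple_transp_comm far) -!mulgA simple_transpK.
  have et : T_word t = T_word (rcons r i).
    apply: IH; rewrite ?reduced_rcons ?word_perm_rcons ?wr ?red_r ?wt //.
      by rewrite descentM des_ij.
    by rewrite simple_transpK.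
  by rewrite es et !T_word_rcons -!mulrA (T_gen_comm far).
have [r red_r wr] := reduced_word_ex (t_ i * (t_ j * (t_ i * w)))%g.
have wr' : word_perm r = (t_ j * (t_ i * (t_ j * w)))%g.
  by rewrite wr !mulgA simple_transp_braid.
have [c [[dji dij] diji djij /(_ des_i des_j) c1 _]] := descent_adj w adj.
have es : T_word s = T_word (rcons (rcons r i) j).
  apply: IH; rewrite ?reduced_rcons ?word_perm_rcons ?wr ?simple_transpK ?red_r ?ws //=.
  by rewrite !descentM dji c1 diji des_j.
have et : T_word t = T_word (rcons (rcons r j) i).
  apply: IH; rewrite ?reduced_rcons ?word_perm_rcons ?wr' ?simple_transpK ?red_r ?wt //=.
  by rewrite !descentM dij c1 djij des_i.
by rewrite es et !T_word_rcons -!mulrA; congr (_ * _); rewrite !mulrA T_gen_braid.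
Qed.

Lemma T_wordE s : reduced s -> T (word_perm s) = T_word s.
Proof.
move=> red_s; rewrite /T_; case: pickP => [r /eqP wr|none].
  by apply: T_word_reduced; rewrite // /reduced wr size_tuple.
have size_s : size s == ell (word_perm s) by [].
by have := none (Tuple size_s); rewrite eqxx.
Qed.

Lemma T1 : T 1%g = 1.
Proof. by rewrite (@T_wordE [::]) ?/T_word ?big_nil // /reduced /= ell1. Qed.

Lemma T_simple i : T (t_ i) = Tg i.
Proof.
have w_i : word_perm [:: i] = t_ i by rewrite /= mul1g.
rewrite -w_i T_wordE ?/T_word ?big_seq1 //.
by rewrite (reduced_rcons [::]) /reduced /= ell1 eqxx /descent !perm1 /= ltnNge leqnSn.
Qed.

Lemma T_ascent i w : ~~ descent i w -> T w * Tg i = T (t_ i * w)%g.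
Proof.
have [s red_s <-] := reduced_word_ex w => asc.
by rewrite -word_perm_rcons !T_wordE ?reduced_rcons ?red_s // T_word_rcons.
Qed.

Lemma T_descent i w : descent i w ->
  T w * Tg i = (q - 1) *: T w + q *: T (t_ i * w)%g.
Proof.
move=> des; have asc : ~~ descent i (t_ i * w)%g by rewrite descentM negbK.
have ew : T w = T (t_ i * w)%g * Tg i by rewrite T_ascent // simple_transpK.
by rewrite {1 2}ew -mulrA T_gen_sq mulrDr -!scalerAr mulr1.
Qed.

End StandardBasis.

(** * Coefficients in the standard basis *)

Section Coefficients.
Variables (F : fieldType) (n : nat).
Implicit Types (i j : 'I_n.-1) (w z : 'S_n) (s : seq 'I_n.-1).
Local Notation t_ := (@simple_transp n).
Local Notation H := (hecke F n).
Local Notation K := (ratfun F).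
Local Notation q := (qpar F).
Local Notation Tg := (@T_gen F n).
Local Notation T := (@T_ F n).
Implicit Types (x y : hterm F n) (f g : 'S_n -> K).

(** The right regular module: a function f on the symmetric group stands for
the sum of the f(z) T_z. *)
Fixpoint hact x f : 'S_n -> K :=
  match x with
  | HScal a => fun z => a * f z
  | HGen i => fun z =>
      if descent i z then f (t_ i * z)%g + (q - 1) * f z else q * f (t_ i * z)%g
  | HAdd x y => fun z => hact x f z + hact y f z
  | HMul x y => hact y (hact x f)
  end.

Lemma hact_linear x a f g :
  hact x (fun z => a * f z + g z) = fun z => a * hact x f z + hact x g z.
Proof.
elim: x a f g => [b|i|x IHx y IHy|x IHx y IHy] a f g /=; last by rewrite IHx IHy.
- by apply/funext=> z; ring.
- by apply/funext=> z; case: ifP => _; ring.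
- by apply/funext=> z; rewrite IHx IHy; ring.
Qed.

Lemma hactD x f g :
  hact x (fun z => f z + g z) = fun z => hact x f z + hact x g z.
Proof.
have := hact_linear x 1 f g; under eq_fun do rewrite mul1r.
by move=> ->; apply/funext=> z; rewrite mul1r.
Qed.

Lemma hactZ x a f : hact x (fun z => a * f z) = fun z => a * hact x f z.
Proof.
have act0 : hact x (fun=> 0) = fun=> 0.
  have := hact_linear x (-1) (fun=> 0) (fun=> 0).
  under eq_fun do rewrite mulr0 addr0.
  by move=> ->; apply/funext=> z; rewrite mulN1r addNr.
have := hact_linear x a f (fun=> 0); under eq_fun do rewrite addr0.
by move=> ->; apply/funext=> z; rewrite act0 addr0.
Qed.

(** Being invariant under the congruence, the module structure descends to the
algebra, which yields coordinates on it without a choice of a basis.  Only the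
quadratic, commutation and braid relations require a case analysis. *)
Lemma hact_heq x y : heq x y -> hact x = hact y.
Proof.
elim=> {x y} /=.
- by [].
- by [].
- by move=> x y z _ -> _ ->.
- by move=> x x' y y' _ -> _ ->.
- by move=> x x' y y' _ -> _ ->.
- by move=> x y z; apply/funext=> f; apply/funext=> w; rewrite addrA.
- by move=> x y; apply/funext=> f; apply/funext=> w; rewrite addrC.
- by move=> x; apply/funext=> f; apply/funext=> w; rewrite mul0r add0r.
- by move=> x; apply/funext=> f; apply/funext=> w; rewrite hactZ mulN1r addNr mul0r.
- by [].
- by move=> x; apply/funext=> f; rewrite hactZ; apply/funext=> w; rewrite mul1r.
- by move=> x y z; apply/funext=> f; rewrite hactD.
- by [].
- by move=> a b; apply/funext=> f; apply/funext=> w; rewrite mulrDl.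
- by move=> a b; apply/funext=> f; apply/funext=> w; rewrite mulrCA mulrA.
- by move=> a x; apply/funext=> f; rewrite hactZ.
- move=> i; apply/funext=> f; apply/funext=> z; rewrite descentM simple_transpK.
  by case: (descent i z) => /=; ring.
- move=> i j far; apply/funext=> f; apply/funext=> z.
  rewrite !descent_far // 1?distnC // !mulgA (simple_transp_comm far).
  by case: (descent i z); case: (descent j z); ring.
- move=> i j adj; apply/funext=> f; apply/funext=> z.
  have [c [[ji ij] iji jij des asc]] := descent_adj z adj.
  rewrite ji ij iji jij !descentM !simple_transpK.
  have -> : (t_ j * (t_ i * (t_ j * z)) = t_ i * (t_ j * (t_ i * z)))%g.
    by rewrite !mulgA (simple_transp_braid adj).
  (* Six of the eight combinations of descents are orders of three values; the
     other two contradict transitivity. *)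
  case: (descent i z) des asc; case: (descent j z) => /= des asc.
  + by rewrite des //=; ring.
  + by case: (c) => /=; ring.
  + by case: (c) => /=; ring.
  + by rewrite (negPf (asc _ _)) //=; ring.
Qed.

(** The coordinate at T_w is read off the image of the vector that stands for
T_e. *)
Definition T_coef (w : 'S_n) (h : H) : K := hact (hrepr h) (fun z => (z == 1%g)%:R) w.

Lemma T_coef_hcls w x : T_coef w (hcls x) = hact x (fun z => (z == 1%g)%:R) w.
Proof. by rewrite /T_coef (hact_heq (hclsE x)). Qed.

Lemma T_coefD w : {morph T_coef w : h k / h + k}.
Proof. by elim/hecke_ind=> x; elim/hecke_ind=> y; rewrite hclsD !T_coef_hcls. Qed.

Lemma T_coefZ w a h : T_coef w (a *: h) = a * T_coef w h.
Proof. by elim/hecke_ind: h => x; rewrite hclsZ !T_coef_hcls /= hactZ. Qed.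

Lemma T_coef0 w : T_coef w 0 = 0.
Proof. by rewrite -[0](scale0r 0) T_coefZ mul0r. Qed.

Lemma T_coefB w : {morph T_coef w : h k / h - k}.
Proof. by move=> h k; rewrite T_coefD -scaleN1r T_coefZ mulN1r. Qed.

Lemma T_coef_sum w (I : Type) (r : seq I) (P : pred I) (h : I -> H) :
  T_coef w (\sum_(i <- r | P i) h i) = \sum_(i <- r | P i) T_coef w (h i).
Proof. exact: (big_morph _ (T_coefD w) (T_coef0 w)). Qed.

Lemma T_coef_T_gen w h i : T_coef w (h * Tg i) =
  if descent i w then T_coef (t_ i * w)%g h + (q - 1) * T_coef w h
  else q * T_coef (t_ i * w)%g h.
Proof. by elim/hecke_ind: h => x; rewrite hclsM !T_coef_hcls. Qed.

Lemma T_coef1 w : T_coef w 1 = (w == 1%g)%:R.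
Proof. by rewrite -[1]/(hcls (HScal 1)) T_coef_hcls /= mul1r. Qed.

(** A reduced word moves the vector of T_e along ascents only, so it stays a
single basis vector.  This is the linear independence of the T_w. *)
Lemma T_coef_T w z : T_coef w (T z) = (w == z)%:R.
Proof.
have [s red_s <-] := reduced_word_ex z; rewrite T_wordE //.
elim/last_ind: s red_s w => [_ w|s i IH]; first by rewrite /T_word big_nil T_coef1.
rewrite reduced_rcons => /andP[red_s asc] w.
rewrite T_word_rcons T_coef_T_gen !IH // word_perm_rcons.
have -> : (w == t_ i * word_perm s)%g = (t_ i * w == word_perm s)%g.
  by rewrite -(inj_eq (can_inj (simple_transpK i))) simple_transpK.
case: (boolP (descent i w)) => [des|asc_w].
  have /negPf -> : w != word_perm s by apply: contraNneq asc => <-.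
  by rewrite mulr0 addr0.
have /negPf -> : (t_ i * w)%g != word_perm s.
  by apply: contraNneq asc => <-; rewrite descentM.
by rewrite mulr0.
Qed.

Lemma T_coef_expansion w (a : 'S_n -> K) : T_coef w (\sum_z a z *: T z) = a w.
Proof.
rewrite T_coef_sum (bigD1 w) //= T_coefZ T_coef_T eqxx mulr1 big1 ?addr0 // => z zw.
by rewrite T_coefZ T_coef_T eq_sym (negPf zw) mulr0.
Qed.

(** The span of the T_z contains 1 and is stable under right multiplication by
the generators. *)
Lemma T_span (x : H) : x = \sum_z T_coef z x *: T z.
Proof.
pose spanned (x : H) := x = \sum_z T_coef z x *: T z.
have spanD (x1 y1 : H) : spanned x1 -> spanned y1 -> spanned (x1 + y1).
  rewrite /spanned => {1}-> {1}->; rewrite -big_split /=.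
  by apply: eq_bigr => z _; rewrite T_coefD scalerDl.
have spanZ a (x1 : H) : spanned x1 -> spanned (a *: x1).
  rewrite /spanned => {1}->; rewrite scaler_sumr.
  by apply: eq_bigr => z _; rewrite T_coefZ scalerA.
have span0 : spanned 0.
  by rewrite /spanned big1 // => z _; rewrite T_coef0 scale0r.
have spanT w : spanned (T w).
  rewrite /spanned (bigD1 w) //= T_coef_T eqxx scale1r big1 ?addr0 // => z zw.
  by rewrite T_coef_T (negPf zw) scale0r.
have spanM i (x1 : H) : spanned x1 -> spanned (x1 * Tg i).
  move=> ->; rewrite mulr_suml; elim/big_ind: _ => // z _; rewrite -scalerAl; apply: (spanZ).
  case: (boolP (descent i z)) => [des|asc]; last by rewrite T_ascent.
  by rewrite T_descent //; apply: spanD; apply: spanZ.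
suff mulS (y : hterm F n) (x1 : H) : spanned x1 -> spanned (x1 * hcls y).
  rewrite -[x](mul1r) -[x]hclsK; apply: mulS; rewrite -T1; exact: spanT.
elim: y x1 => [a|i|y1 IH1 y2 IH2|y1 IH1 y2 IH2] x1 sx1.
- have -> : x1 * hcls (HScal a) = a *: x1 by rewrite -[LHS](hscalC a x1).
  exact: spanZ.
- exact: spanM.
- by rewrite -hclsD mulrDr; apply: spanD; [apply: IH1|apply: IH2].
- by rewrite -hclsM mulrA; apply/IH2/IH1.
Qed.

End Coefficients.

(** * The bar involution and the uniqueness of the Kazhdan-Lusztig basis *)

Section EvalQ.
Variable F : fieldType.
Local Notation K := (ratfun F).
Local Notation q := (qpar F).
Local Notation v := (vpar F).

Lemma vpar_neq0 : v != 0. Proof. by rewrite tofrac_eq0 polyX_eq0. Qed.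
Lemma qpar_neq0 : q != 0. Proof. by rewrite expf_neq0 // vpar_neq0. Qed.

Lemma eval_qD : {morph eval_q F : p r / p + r}.
Proof. by move=> p r; rewrite /eval_q rmorphD hornerD. Qed.
Lemma eval_qB : {morph eval_q F : p r / p - r}.
Proof. by move=> p r; rewrite /eval_q rmorphB hornerD hornerN. Qed.
Lemma eval_qM : {morph eval_q F : p r / p * r}.
Proof. by move=> p r; rewrite /eval_q rmorphM hornerM. Qed.
Lemma eval_q0 : eval_q F 0 = 0. Proof. by rewrite /eval_q rmorph0 horner0. Qed.
Lemma eval_q1 : eval_q F 1 = 1. Proof. by rewrite /eval_q rmorph1 hornerC. Qed.
Lemma eval_qX : eval_q F 'X = q. Proof. by rewrite /eval_q map_polyX hornerX. Qed.

Lemma eval_q_tofrac (p : {poly int}) :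
  eval_q F p = tofrac ((map_poly intr p : {poly F}) \Po 'X^2).
Proof.
rewrite /eval_q /qpar /vpar -rmorphXn /= /comp_poly -horner_map.
congr (_.[_]); apply/polyP=> i.
by rewrite !coef_map /= !rmorph_int.
Qed.

Hypothesis char0 : [pchar F] =i pred0.

Lemma intr_eq0_char0 (k : int) : (k%:~R == 0 :> F) = (k == 0).
Proof.
have /pcharf0P nat0 := char0.
by case: k => k; rewrite ?NegzE ?mulrNz ?oppr_eq0 -?pmulrn nat0.
Qed.

Lemma eval_q_eq0 p : eval_q F p = 0 -> p = 0.
Proof.
rewrite eval_q_tofrac => /eqP; rewrite tofrac_eq0 => /eqP p0.
apply/polyP=> i; apply/eqP; rewrite coef0 -intr_eq0_char0.
have := congr1 (fun r : {poly F} => r`_(i * 2)) p0.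
by rewrite coef0 coef_comp_poly_Xn // dvdn_mull // mulnK // coef_map /= => ->.
Qed.

Lemma eval_q_inj : injective (eval_q F).
Proof.
move=> p r /eqP; rewrite -subr_eq0 -eval_qB => /eqP/eval_q_eq0/eqP.
by rewrite subr_eq0 => /eqP.
Qed.

(** The hypothesis says that R(q) = q^m R(1/q) with m = l - k.  The left side
has degree below m/2, while all the exponents on the right side exceed m/2. *)
Lemma bar_symmetric_small (R : {poly int}) l k : (size R <= uphalf (l - k))%N ->
  (map_poly intr R).[q^-1] * q ^- k = q ^- l * eval_q F R -> R = 0.
Proof.
move=> szR eqR.
case: (leqP l k) => [lk|kl].
  by apply/eqP; rewrite -size_poly_leq0 (leq_trans szR) // (eqP lk).
have [m lm] : exists m, l = (m + k)%N by exists (l - k)%N; rewrite subnK // ltnW.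
move: szR eqR; rewrite {}lm addnK => szR.
have szm : (size R <= m)%N by lia.
(* S is q^m R(1/q). *)
pose S : {poly int} := \sum_(i < size R) R`_i *: 'X^(m - i).
move=> eqR; have {eqR} eqR : eval_q F R = eval_q F S.
  apply: (mulfI (invr_neq0 (expf_neq0 (m + k) qpar_neq0))); rewrite -eqR.
  rewrite /eval_q /S rmorph_sum horner_sum mulr_sumr.
  rewrite (@horner_coef_wide _ (size R)) ?size_poly //.
  rewrite mulr_suml; apply: eq_bigr => i _.
  rewrite /= map_polyZ map_polyXn hornerZ hornerXn coef_map /= !mulrA.
  have im : (i <= m)%N by rewrite (leq_trans _ szm) // ltnW.
  have cancel (L : fieldType) (x a b c : L) : a != 0 -> b != 0 -> c != 0 ->
      x * a^-1 / b = (c * a * b)^-1 * x * c.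
    by move=> a0 b0 c0; field; rewrite a0 b0 c0.
  rewrite -[in q ^- (m + k)](subnK im) !exprD exprVn.
  by apply: cancel; rewrite expf_neq0 // qpar_neq0.
move/eval_q_inj: eqR => eqR; apply/polyP=> i; rewrite coef0.
have [iR|] := ltnP i (size R); last exact: nth_default.
rewrite eqR coef_sum big1 // => j _; rewrite coefZ coefXn.
have -> : (i == m - j)%N = false by have := ltn_ord j; lia.
by rewrite mulr0.
Qed.
End EvalQ.

Section Bar.
Variables (F : fieldType) (n : nat).
Implicit Types (i j : 'I_n.-1) (w z : 'S_n) (s : seq 'I_n.-1).
Local Notation t_ := (@simple_transp n).
Local Notation H := (hecke F n).
Local Notation K := (ratfun F).
Local Notation q := (qpar F).
Local Notation v := (vpar F).
Local Notation Tg := (@T_gen F n).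
Local Notation T := (@T_ F n).

Variable iota : {rmorphism H -> H}.
Hypothesis hiota : bar_involution iota.

Lemma bar_vX l h : iota (v ^+ l *: h) = v ^- l *: iota h.
Proof.
have [_ _ bv _] := hiota.
rewrite -mulr_algl rmorphM /= -[v ^- l *: _]mulr_algl; congr (_ * _).
have algX (a : K) : (a ^+ l)%:A = a%:A ^+ l :> H by rewrite exprZn expr1n.
by rewrite -exprVn !algX rmorphXn /= bv.
Qed.

Lemma bar_eval_q p h :
  iota (eval_q F p *: h) = (map_poly intr p).[q^-1] *: iota h.
Proof.
have bq : iota q%:A = q^-1%:A.
  by rewrite -[q%:A]/(v ^+ 2 *: 1) bar_vX rmorph1.
rewrite -mulr_algl rmorphM /= -[X in _ = X]mulr_algl; congr (_ * _).
have algE (a : K) : (map_poly intr p).[a]%:A = (map_poly intr p).[a%:A] :> H.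
  rewrite -[LHS]/(GRing.in_alg H _) -(horner_map (GRing.in_alg H)).
  by congr (_.[_]); apply/polyP=> i; rewrite !coef_map /= -[LHS]/(GRing.in_alg H _) rmorph_int.
rewrite /eval_q !algE -horner_map -bq.
by congr (_.[_]); apply/polyP=> i; rewrite !coef_map /= rmorph_int.
Qed.

Lemma bar_T_gen i : iota (Tg i) = q^-1 *: (Tg i - (q - 1)%:A).
Proof.
have [_ _ _ /(_ (t_ i)) []] := hiota.
have -> : (t_ i)^-1%g = t_ i by rewrite tpermV.
rewrite T_simple => bT _.
have Tinv : Tg i * (q^-1 *: (Tg i - (q - 1)%:A)) = 1.
  rewrite -scalerAr mulrBr T_gen_sq -scalerAr mulr1 addrAC subrr add0r.
  by rewrite scalerA mulVf ?scale1r ?qpar_neq0.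
by rewrite -[LHS]mulr1 -[X in _ * X = _]Tinv mulrA bT mul1r.
Qed.

(** The bar involution maps T_i to its inverse, so this is the action of the
inverse on coordinates. *)
Lemma T_coef_bar_T_gen z h i : T_coef z (h * iota (Tg i)) =
  if descent i z then q^-1 * T_coef (t_ i * z)%g h
  else T_coef (t_ i * z)%g h - (1 - q^-1) * T_coef z h.
Proof.
rewrite bar_T_gen -scalerAr T_coefZ mulrBr T_coefB T_coef_T_gen -scalerAr mulr1 T_coefZ.
case: ifP => _; first by rewrite addrK.
by rewrite mulrBr mulKf ?qpar_neq0 // mulrA mulrBr mulVf ?qpar_neq0 // mulr1.
Qed.

(** The bar image of T_w is q^-l(w) T_w up to terms of smaller length. *)
Lemma T_coef_bar_T w z : (ell w <= ell z)%N ->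
  T_coef z (iota (T w)) = (z == w)%:R * q ^- ell w.
Proof.
have [s red_s <-] := reduced_word_ex w; rewrite T_wordE // {w}.
elim/last_ind: s red_s z => [_ z _|s i IH].
  by rewrite /T_word big_nil rmorph1 T_coef1 ell1 expr0 invr1 mulr1.
rewrite reduced_rcons => /andP[red_s asc] z.
rewrite word_perm_rcons ell_ascent // => lz.
rewrite T_word_rcons rmorphM /= T_coef_bar_T_gen.
have -> : (z == t_ i * word_perm s)%g = (t_ i * z == word_perm s)%g.
  by rewrite -(inj_eq (can_inj (simple_transpK i))) simple_transpK.
case: (boolP (descent i z)) => [des|asc_z].
  have lz' := ell_descent des; rewrite lz' ltnS in lz.
  by rewrite IH // exprS [(q * _)^-1]invfM mulrCA.
have ne : (t_ i * z)%g != word_perm s by apply: contraNneq asc => <-; rewrite descentM.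
have ne' : z != word_perm s by apply: contraTneq lz => ->; rewrite ltnn.
have lz' : (ell (word_perm s) <= ell (t_ i * z)%g)%N by rewrite ell_ascent //; lia.
rewrite (IH _ z (ltnW lz)) // (IH _ (t_ i * z)%g lz') //.
by rewrite (negPf ne) (negPf ne') !mul0r mulr0 subr0.
Qed.

Hypothesis char0 : [pchar F] =i pred0.
Variables (C' : 'S_n -> H) (P : 'S_n -> 'S_n -> {poly int}).
Hypothesis hKL : KL_basis iota C' P.

(** Only lengths enter the hypotheses on d, so that the Bruhat order is an
outcome and not an input.  The difference of the two elements is invariant and
its coefficients obey the degree bounds.  At an element z0 of maximal length in
its support the bar involution acts as on q^-l(z0) T_(z0) alone, and
[bar_symmetric_small] makes the coefficient vanish. *)
Theorem KL_basis_unique w (d : 'S_n -> {poly int}) :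
    d w = 1 ->
    (forall z, z != w -> (size (d z) <= uphalf (ell w - ell z))%N) ->
    let D := \sum_z eval_q F (d z) *: T z in
    iota D = q ^- ell w *: D ->
  v ^+ ell w *: C' w = D /\ forall z, d z = if bruhat z w then P z w else 0.
Proof.
move=> dw dsz D bD; have [bC EC Pw Psz] := hKL w.
pose p z : {poly int} := if bruhat z w then P z w else 0.
have EE : v ^+ ell w *: C' w = \sum_z eval_q F (p z) *: T z.
  rewrite EC big_mkcond; apply: eq_bigr => z _; rewrite /p.
  by case: ifP; rewrite ?eval_q0 ?scale0r.
pose R z := p z - d z.
suff R0 : forall z, R z = 0.
  have pd z : p z = d z by apply/eqP; rewrite -subr_eq0 -/(R z) R0.
  by split=> [|z]; rewrite ?EE -?pd //; apply: eq_bigr => z _; rewrite pd.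
have XE : v ^+ ell w *: C' w - D = \sum_z eval_q F (R z) *: T z.
  by rewrite EE -sumrB; apply: eq_bigr => u _; rewrite -scalerBl eval_qB.
have Rsz u : (size (R u) <= uphalf (ell w - ell u))%N.
  rewrite /R; have [->|uw] := eqVneq u w.
    by rewrite /p /bruhat connect0 Pw dw subrr size_poly0.
  rewrite (leq_trans (size_polyD _ _)) // size_polyN geq_max dsz // andbT /p.
  case: ifP => [bu|_]; last by rewrite size_poly0.
  by have := Psz u bu uw; lia.
have bX : iota (v ^+ ell w *: C' w - D) = q ^- ell w *: (v ^+ ell w *: C' w - D).
  rewrite rmorphB /= bD scalerBr bar_vX bC scalerA; congr (_ *: _ - _).
  rewrite /qpar -exprM mulnC exprM expr2 invfM -mulrA mulVf ?mulr1 //.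
  by rewrite expf_neq0 ?vpar_neq0.
move: bX; rewrite XE rmorph_sum /= => bX.
move=> y; apply/eqP/negPn/negP=> Ry.
pose z0 := [arg max_(u > y | R u != 0) ell u].
have [Rz0 maxz0] : R z0 != 0 /\ forall u, R u != 0 -> (ell u <= ell z0)%N.
  by rewrite /z0; case: arg_maxnP => // u.
case/negP: Rz0; apply/eqP; apply: (bar_symmetric_small char0 (Rsz z0)).
have := congr1 (T_coef z0) bX.
rewrite T_coefZ (T_coef_expansion z0 (fun u => eval_q F (R u))) T_coef_sum => <-.
rewrite (bigD1 z0) //= bar_eval_q T_coefZ T_coef_bar_T // eqxx mul1r big1 ?addr0 // => u uz0.
have [->|Ru] := eqVneq (R u) 0; first by rewrite eval_q0 scale0r rmorph0 T_coef0.
by rewrite bar_eval_q T_coefZ T_coef_bar_T ?maxz0 // eq_sym (negPf uz0) mul0r mulr0.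
Qed.
End Bar.

(** * Sums over permutations bounded by a function *)

Section Hessenberg.
Variables (F : fieldType) (n : nat).
Implicit Types (i j : 'I_n.-1) (w z : 'S_n) (h : 'I_n -> nat).
Local Notation t_ := (@simple_transp n).
Local Notation H := (hecke F n).
Local Notation K := (ratfun F).
Local Notation q := (qpar F).
Local Notation Tg := (@T_gen F n).
Local Notation T := (@T_ F n).

Definition below h : {set 'S_n} := [set z : 'S_n | [forall a, (z a < h a)%N]].

Definition set_at h (a : 'I_n) k : 'I_n -> nat := fun b => if b == a then k else h b.

Definition below_sum h : H := \sum_(z in below h) T z.

Lemma belowP h z : reflect (forall a, (z a < h a)%N) (z \in below h).
Proof. by rewrite inE; apply: forallP. Qed.

Lemma below_transp h i z : h (lo i) = h (hi i) -> (t_ i * z \in below h)%g = (z \in below h).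
Proof.
move=> hE; have sub u : u \in below h -> (t_ i * u \in below h)%g.
  move=> /belowP bu; apply/belowP=> a; rewrite permM simple_transpE.
  by case: tpermP => [->|->|_ _]; rewrite ?hE -?hE // ?hE.
by apply/idP/idP=> [/sub|/sub //]; rewrite simple_transpK.
Qed.

(** Such a sum is a multiple of 1 + T_i from the right, hence an eigenvector
of T_i with eigenvalue q. *)
Lemma sum_T_stable (A : {set 'S_n}) i :
    (forall z, (t_ i * z \in A)%g = (z \in A)) ->
  (\sum_(z in A) T z) * Tg i = q *: (\sum_(z in A) T z).
Proof.
move=> stA; rewrite mulr_suml scaler_sumr.
rewrite (bigID (descent i)) [RHS](bigID (descent i)) /=.
have swap (a : K) : \sum_(z in A | ~~ descent i z) a *: T (t_ i * z)%g
    = \sum_(z in A | descent i z) a *: T z.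
  rewrite (reindex_inj (can_inj (simple_transpK i))) /=.
  by apply: eq_big => z; rewrite ?stA ?descentM ?negbK // simple_transpK.
under eq_bigr => z /andP[_ des] do rewrite T_descent //.
under [X in _ + X]eq_bigr => z /andP[_ asc] do rewrite T_ascent // -[T _]scale1r.
rewrite swap big_split /= addrAC -big_split /=; congr (_ + _).
  by apply: eq_bigr => z _; rewrite -scalerDl subrK.
rewrite [RHS](reindex_inj (can_inj (simple_transpK i))) /=.
by apply: eq_bigl => z; rewrite stA descentM negbK.
Qed.

(** The summands of the first factor with z(i+1) < k are stable under s_i and
contribute (1 + q) times their sum.  The others satisfy z(i) < k = z(i+1), so
that T_z (1 + T_i) = T_z + T_(z s_i), and the z s_i are the elements of the
larger sum that are missing so far. *)
Lemma below_sum_modular h i k : h (lo i) = k.+1 -> h (hi i) = k.+1 ->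
  let h1 := set_at h (lo i) k in
  below_sum h1 * (1 + Tg i) = below_sum h + q *: below_sum (set_at h1 (hi i) k).
Proof.
move=> hl hr h1; set h0 := set_at h1 (hi i) k.
have b1P z : (z \in below h1) = (z \in below h) && (z (lo i) != k :> nat).
  apply/belowP/andP=> [b1|[/belowP b bl] a].
    split; last by have := b1 (lo i); rewrite /h1 /set_at eqxx; lia.
    apply/belowP=> a; have := b1 a; rewrite /h1 /set_at; case: eqP => // ->; lia.
  by have := b a; rewrite /h1 /set_at; case: eqP => // ->; rewrite hl; lia.
have b0P z : (z \in below h0) = (z \in below h1) && (z (hi i) != k :> nat).
  have h1r : h1 (hi i) = k.+1 by rewrite /h1 /set_at eq_sym (negPf (lo_neq_hi i)).
  apply/belowP/andP=> [b1|[/belowP b bl] a].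
    split; last by have := b1 (hi i); rewrite /h0 /set_at eqxx; lia.
    apply/belowP=> a; have := b1 a; rewrite {1}/h0 /set_at; case: eqP => // ->; lia.
  by have := b a; rewrite /h0 /set_at; case: eqP => // ->; rewrite h1r; lia.
have st0 z : (t_ i * z \in below h0)%g = (z \in below h0).
  apply: below_transp; rewrite /h0 /h1 /set_at eqxx.
  by case: eqP => // _; rewrite eqxx.
pose A := [set z in below h1 | z (hi i) == k :> nat].
have splitA : below_sum h1 = below_sum h0 + \sum_(z in A) T z.
  rewrite /below_sum (bigID (fun z : 'S_n => z (hi i) == k :> nat)) addrC /=.
  by congr (_ + _); apply: eq_bigl => z; rewrite ?b0P ?inE.
have splitB : below_sum h = below_sum h1 + (\sum_(z in A) T z) * Tg i.
  rewrite /below_sum (bigID (fun z : 'S_n => z (lo i) != k :> nat)) /=.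
  congr (_ + _); first by apply: eq_bigl => z; rewrite b1P.
  rewrite mulr_suml (reindex_inj (can_inj (simple_transpK i))) /=.
  have memA z : (z \in A) = (t_ i * z \in below h)%g && ~~ ((t_ i * z)%g (lo i) != k :> nat).
    rewrite inE b1P below_transp ?hl ?hr // permM tpermL negbK -andbA.
    congr (_ && _); case: (nat_of_ord (z (hi i)) =P k) => [zr|_]; last by rewrite andbF.
    by rewrite andbT -zr (inj_eq (@ord_inj n)) (inj_eq perm_inj) lo_neq_hi.
  apply: eq_big => z; first by rewrite memA.
  rewrite -memA inE b1P => /andP[/andP[/belowP b _] /eqP zr]; rewrite T_ascent //.
  by rewrite /descent zr -leqNgt -ltnS -hl.
rewrite mulrDr mulr1 {2}splitA mulrDl (sum_T_stable st0) splitB.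
by rewrite -addrA [q *: _ + _]addrC.
Qed.

Variable iota : {rmorphism H -> H}.
Hypothesis hiota : bar_involution iota.

Lemma bar_1T i : iota (1 + Tg i) = q^-1 *: (1 + Tg i).
Proof.
rewrite rmorphD rmorph1 (bar_T_gen hiota) scalerBr scalerDr scalerA mulrBr.
by rewrite mulr1 mulVf ?qpar_neq0 // scalerBl scale1r opprB addrCA [1 + _]addrC subrK addrC.
Qed.

(** The exponents are arranged so that the statement also holds when no
permutation is bounded by h, both sides being 0; this keeps the induction free
of side conditions.  If two consecutive values of h agree, the modular law
applies; otherwise h is strictly increasing, which forces h(a) = a + 1 or the
presence of a value 0. *)
Lemma bar_below_sum h :
    (forall i, (h (lo i) <= h (hi i))%N) -> (forall a, (h a <= n)%N) ->
  q ^+ (\sum_a h a) *: iota (below_sum h) = q ^+ (\sum_(a < n) a.+1) *: below_sum h.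
Proof.
have [m] : exists m, (\sum_a h a < m)%N by exists (\sum_a h a).+1.
elim: m h => // m IH h hm mono bnd.
case: (pickP (fun a => h a == 0%N)) => [a /eqP ha|nz].
  have -> : below_sum h = 0; last by rewrite rmorph0 !scaler0.
  by apply: big_pred0 => z; apply/belowP=> /(_ a); rewrite ha.
have pos a : (0 < h a)%N by rewrite lt0n nz.
have [/existsP[j0 j0P]|/existsPn incr] := boolP [exists i, h (lo i) == h (hi i)].
  (* The first such position, so that lowering h there keeps it weakly
     increasing. *)
  pose i := [arg min_(j < j0 | h (lo j) == h (hi j)) (j : nat)].
  have [/eqP hE imin] : h (lo i) == h (hi i)
      /\ forall j, h (lo j) == h (hi j) -> (i <= j)%N.
    by rewrite /i; case: arg_minnP => // j.
  have [k hk] : exists k, h (lo i) = k.+1 by exists (h (lo i)).-1; rewrite prednK.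
  have := below_sum_modular hk (etrans (esym hE) hk).
  set h1 := set_at h (lo i) k; set h0 := set_at h1 (hi i) k => /= modular.
  have h1r : h1 (hi i) = k.+1.
    by rewrite /h1 /set_at eq_sym (negPf (lo_neq_hi i)) -hE.
  have sum1 : (\sum_a h a = (\sum_a h1 a).+1)%N.
    rewrite (bigD1 (lo i)) //= [in RHS](bigD1 (lo i)) //= {1}/h1 /set_at eqxx hk addSn.
    by congr (_ + _).+1; apply: eq_bigr => a /negPf ne; rewrite /h1 /set_at ne.
  have sum0 : (\sum_a h1 a = (\sum_a h0 a).+1)%N.
    rewrite (bigD1 (hi i)) //= [in RHS](bigD1 (hi i)) //= {1}/h0 /set_at eqxx h1r addSn.
    by congr (_ + _).+1; apply: eq_bigr => a /negPf ne; rewrite /h0 /set_at ne.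
  have mono1 j : (h1 (lo j) <= h1 (hi j))%N.
    rewrite /h1 /set_at; have := mono j; case: eqP => [lj|_]; case: eqP => [hj|_] //.
    - by rewrite lj hk; lia.
    - rewrite hj hk => le_k; have : h (lo j) != k.+1; last by lia.
      have ij : i = j.+1 :> nat by have := congr1 val hj => /= ->.
      by apply/eqP=> ljk; have := imin j; rewrite hj hk ljk eqxx => /(_ isT); lia.
  have mono0 j : (h0 (lo j) <= h0 (hi j))%N.
    rewrite /h0 /set_at; have := mono1 j; case: eqP => [lj|_]; case: eqP => [hj|_] //.
    - by rewrite lj h1r; lia.
    - have -> : j = i by apply/val_inj; have := congr1 val hj => /= -[].
      by rewrite /h1 /set_at eqxx.
  have bnd1 a : (h1 a <= n)%N.
    by rewrite /h1 /set_at; case: eqP => // _; rewrite ltnW // -hk.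
  have bnd0 a : (h0 a <= n)%N.
    by rewrite /h0 /set_at; case: eqP => // _; rewrite ltnW // -hk.
  have IH1 := IH h1 _ mono1 bnd1; have IH0 := IH h0 _ mono0 bnd0.
  have -> : below_sum h = below_sum h1 * (1 + Tg i) - q *: below_sum h0.
    by rewrite modular addrK.
  have iq : iota (q *: below_sum h0) = q^-1 *: iota (below_sum h0).
    exact: (bar_vX hiota 2).
  rewrite rmorphB rmorphM /= bar_1T iq scalerBr [in RHS]scalerBr.
  rewrite -scalerAr -2?scalerAl sum1 sum0; congr (_ - _).
    rewrite scalerA exprS mulrC mulKf ?qpar_neq0 // scalerAl -sum0 IH1 -?scalerAl //; lia.
  rewrite scalerA exprSr mulfK ?qpar_neq0 // exprS -scalerA IH0; last by lia.
  by rewrite !scalerA mulrC.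
have hid (a : 'I_n) : h a = a.+1.
  have incr' i : (h (lo i) < h (hi i))%N by rewrite ltn_neqAle incr mono.
  have [c ac] : exists c, nat_of_ord a = c by exists a.
  apply/eqP; rewrite eqn_leq; apply/andP; split.
    have [d ad] : exists d, (a + d).+1 = n by exists (n - a.+1)%N; have := ltn_ord a; lia.
    elim: d a ad {c ac} => [|d IHd] a ad; first by rewrite (leq_trans (bnd a)) //; lia.
    have an : (a < n.-1)%N by lia.
    have ea : a = lo (Ordinal an) by apply/val_inj.
    have := incr' (Ordinal an); have := IHd (hi (Ordinal an)); rewrite -ea /=; lia.
  elim: c a ac => [|c IHc] a ac; first by rewrite ac pos.
  have an : (c < n.-1)%N by have := ltn_ord a; lia.
  have ea : a = hi (Ordinal an) by apply/val_inj.
  have := incr' (Ordinal an); have := IHc (lo (Ordinal an)) erefl; rewrite -ea /=; lia.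
have -> : below_sum h = 1.
  rewrite /below_sum (big_pred1 1%g) ?T1 // => z /=.
  apply/belowP/eqP=> [b|-> a]; last by rewrite perm1 hid.
  by apply: perm_le_id => a; have := b a; rewrite hid.
by rewrite rmorph1; under eq_bigr do rewrite hid.
Qed.

End Hessenberg.

(** * Codominant permutations *)

Section Codominant.
Variable n : nat.
Implicit Types (w z : 'S_n) (h : 'I_n -> nat) (a b c : 'I_n).

(** The Lehmer code. *)
Definition code z a : nat := #|[set b : 'I_n | (a < b)%N && (z b < z a)%N]|.

Lemma ell_code z : ell z = (\sum_a code z a)%N.
Proof.
rewrite /ell -sum1_card
  (eq_bigl (fun p : 'I_n * 'I_n => true && ((p.1 < p.2)%N && (z p.2 < z p.1)%N))).
  rewrite -(pair_big_dep xpredT (fun a b => (a < b)%N && (z b < z a)%N) (fun _ _ => 1%N)) /=.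
  by apply: eq_bigr => a _; rewrite sum1_card /code cardsE.
by move=> p; rewrite inE.
Qed.

Lemma card_ord_lt (k : nat) : (k <= n)%N -> #|[set c : 'I_n | (c < k)%N]| = k.
Proof.
move=> kn; rewrite cardsE -sum1_card -(big_ord_widen n (fun=> 1%N) kn).
by rewrite sum_nat_const card_ord muln1.
Qed.

Let earlier_or_smaller z a := [set b : 'I_n | (b <= a)%N || (z b < z a)%N].

(** The two conditions exclude each other among the positions that define the
code. *)
Lemma card_earlier_or_smaller z a : #|earlier_or_smaller z a| = (code z a + a.+1)%N.
Proof.
rewrite -(card_ord_lt (ltn_ord a)) -cardsUI.
have -> : [set b : 'I_n | (a < b)%N && (z b < z a)%N] :&: [set b : 'I_n | (b < a.+1)%N] = set0.
  by apply/setP=> b; rewrite !inE; lia.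
rewrite cards0 addn0; apply: eq_card => b; rewrite !inE ltnS.
by case: (ltnP a b) => ab //=; rewrite ?orbF ?orbT.
Qed.

Section Bounded.
Variables (h : 'I_n -> nat) (z : 'S_n).
Hypothesis mono : forall a b, (a <= b)%N -> (h a <= h b)%N.
Hypothesis bnd : forall a, (h a <= n)%N.
Hypothesis zh : z \in below h.

(** Every value taken at a position up to a is below h(a) because h is weakly
increasing, and so is every value smaller than z(a). *)
Lemma image_earlier_or_smaller a :
  [set z b | b in earlier_or_smaller z a] \subset [set c : 'I_n | (c < h a)%N].
Proof.
apply/subsetP=> _ /imsetP[b + ->]; rewrite !inE.
move/belowP: zh => zh' /orP[ba|ba]; first by rewrite (leq_trans (zh' b)) ?mono.
by rewrite (ltn_trans ba) ?zh'.
Qed.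

Lemma code_below a : (code z a + a.+1 <= h a)%N.
Proof.
rewrite -card_earlier_or_smaller -(card_imset _ (@perm_inj _ z)).
by rewrite -[leqRHS](card_ord_lt (bnd a)) subset_leq_card ?image_earlier_or_smaller.
Qed.

Lemma code_belowE a : reflect (forall b, (a < b)%N -> (z b < h a)%N -> (z b < z a)%N)
  (code z a + a.+1 == h a)%N.
Proof.
rewrite -card_earlier_or_smaller -(card_imset _ (@perm_inj _ z)).
rewrite -[X in _ == X](card_ord_lt (bnd a)).
have sub := image_earlier_or_smaller a; have := subset_leqif_cards sub => -[_ ->].
apply: (iffP eqP) => [/setP im b ab bh|small].
  have := im (z b); rewrite inE bh => /imsetP[b' + /perm_inj eb]; rewrite -eb inE.
  by rewrite leqNgt ab.
apply/eqP; rewrite eqEsubset sub; apply/subsetP=> c; rewrite inE => ch.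
apply/imsetP; exists (z^-1%g c); last by rewrite permKV.
by rewrite inE; case: (leqP (z^-1%g c) a) => //= ac; apply: small; rewrite // permKV.
Qed.

End Bounded.

(** The running maxima of w, shifted by one: the smallest weakly increasing
bound for w. *)
Definition bound w a : nat := \max_(b : 'I_n | (b <= a)%N) (w b).+1.

Lemma bound_le w a : (bound w a <= n)%N.
Proof. by apply/bigmax_leqP=> b _; apply: ltn_ord. Qed.

Lemma bound_mono w a b : (a <= b)%N -> (bound w a <= bound w b)%N.
Proof.
move=> ab; apply/bigmax_leqP=> c ca.
by rewrite (@leq_bigmax_cond _ _ (fun c => (w c).+1)) // (leq_trans ca).
Qed.

Lemma mem_below_bound w : w \in below (bound w).
Proof.
by apply/belowP=> a; rewrite /bound (@leq_bigmax_cond _ _ (fun c => (w c).+1)) //.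
Qed.

(** If a value below the running maximum occurs after position a and is larger
than w(a), it forms a pattern 312 with that maximum and w(a). *)
Lemma code_codominant w a : codominant w -> (code w a + a.+1)%N = bound w a.
Proof.
move=> cod; apply/eqP/code_belowE; [exact: bound_mono|exact: bound_le|exact: mem_below_bound|].
move=> b ab; rewrite /bound => bh.
have [c ca cE] : exists2 c : 'I_n, (c <= a)%N & bound w a = (w c).+1.
  have [|c ca cE] := @eq_bigmax_cond _ (fun b : 'I_n => (b <= a)%N) (fun c => (w c).+1).
    by apply/card_gt0P; exists a; rewrite unfold_in /=.
  by exists c.
move: bh; rewrite -/(bound w a) cE ltnS => bh.
have ne_ab : w a != w b :> nat.
  by rewrite (inj_eq (@ord_inj n)) (inj_eq perm_inj) -val_eqE /= neq_ltn ab.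
have ne_bc : w b != w c :> nat.
  by rewrite (inj_eq (@ord_inj n)) (inj_eq perm_inj) -val_eqE /=; lia.
have [eac|nac] := eqVneq a c; first by rewrite eac in ne_ab *; lia.
have ltca : (c < a)%N by rewrite ltn_neqAle ca andbT eq_sym.
move/forallP/(_ c)/forallP/(_ a)/forallP/(_ b): cod; rewrite ltca ab /=; lia.
Qed.

Lemma ell_codominant w : codominant w ->
  (ell w + \sum_(a < n) a.+1 = \sum_(a < n) bound w a)%N.
Proof.
move=> cod; rewrite ell_code -big_split /=.
by apply: eq_bigr => a _; apply: code_codominant.
Qed.

(** The codes of z are bounded by those of w.  If all of them agree, then at
every position both permutations take the largest value that is below the bound
and has not been used, so they agree from left to right. *)
Lemma ell_below_codominant w z : codominant w -> z \in below (bound w) -> z != w ->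
  (ell z < ell w)%N.
Proof.
move=> cod zb; apply: contraNltn; rewrite !ell_code => le_wz.
have le_code a : (code z a <= code w a)%N.
  rewrite -(leq_add2r a.+1) (code_codominant _ cod).
  exact: (code_below (@bound_mono w) (@bound_le w) zb).
have eq_code a : code z a = code w a.
  have : (\sum_a (code w a - code z a) = 0)%N.
    by rewrite sumnB //; apply/eqP; rewrite subn_eq0.
  move/eqP; rewrite sum_nat_eq0 => /forallP/(_ a).
  by have := le_code a; rewrite /=; lia.
have full u : u \in below (bound w) -> (forall a, code u a = code w a) ->
    forall a b, (a < b)%N -> (u b < bound w a)%N -> (u b < u a)%N.
  move=> ub ue a; apply/code_belowE; [exact: bound_mono|exact: bound_le|by []|].
  by rewrite ue code_codominant.
have step u1 u2 a : u1 \in below (bound w) -> u2 \in below (bound w) ->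
    (forall a, code u2 a = code w a) ->
    (forall b, (b < a)%N -> u1 b = u2 b) -> (u1 a <= u2 a)%N.
  move=> u1b u2b ue agree; pose b := (u2^-1)%g (u1 a).
  have u2b_eq : u2 b = u1 a by rewrite /b permKV.
  have [ba|ab|/val_inj ba] := ltngtP b a.
  - by have := agree b ba; rewrite u2b_eq => /perm_inj eba; rewrite eba ltnn in ba.
  - rewrite -u2b_eq ltnW // full // u2b_eq; exact: (belowP _ _ u1b).
  - by rewrite -u2b_eq ba.
apply/eqP/permP=> a; have [k] : exists k, (a < k)%N by exists a.+1.
elim: k a => // k IH a ak; apply/val_inj/eqP; rewrite eqn_leq /=.
have agree b : (b < a)%N -> z b = w b by move=> ba; apply: IH; lia.
rewrite !step //; try exact: mem_below_bound.
by move=> b /agree ->.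
Qed.
End Codominant.

(** * Kazhdan-Lusztig elements of codominant permutations *)

Section CodominantKL.
Variables (F : fieldType) (n : nat).
Implicit Types (i j : 'I_n.-1) (w z : 'S_n) (h : 'I_n -> nat).
Local Notation t_ := (@simple_transp n).
Local Notation H := (hecke F n).
Local Notation K := (ratfun F).
Local Notation q := (qpar F).
Local Notation v := (vpar F).
Local Notation Tg := (@T_gen F n).
Local Notation T := (@T_ F n).

Hypothesis char0 : [pchar F] =i pred0.
Variable iota : {rmorphism H -> H}.
Hypothesis hiota : bar_involution iota.

Lemma bar_below_bound w : codominant w ->
  iota (below_sum F (bound w)) = q ^- ell w *: below_sum F (bound w).
Proof.
move=> cod; have := bar_below_sum hiota _ (bound_le w).
rewrite -(ell_codominant cod) => barE.
have {}barE := barE (fun i => bound_mono w (leqnSn i : lo i <= hi i)%N).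
have q0 m : q ^+ m != 0 by rewrite expf_neq0 // qpar_neq0.
apply: (scalerI (q0 (ell w + \sum_(a < n) a.+1)%N)); rewrite barE scalerA.
by rewrite addnC exprD mulfK.
Qed.

Variables (C' : 'S_n -> H) (P : 'S_n -> 'S_n -> {poly int}).
Hypothesis hKL : KL_basis iota C' P.

(** All coefficients are 0 or 1, so the degree bounds only require that w be
longer than the other elements of the sum. *)
Theorem KL_codominant w : codominant w ->
  v ^+ ell w *: C' w = below_sum F (bound w).
Proof.
move=> cod; pose d z : {poly int} := (z \in below (bound w))%:R.
have DE : below_sum F (bound w) = \sum_z eval_q F (d z) *: T z.
  rewrite /below_sum big_mkcond; apply: eq_bigr => z _; rewrite /d.
  by case: ifP => _; rewrite ?eval_q1 ?eval_q0 ?scale1r ?scale0r.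
rewrite DE; apply: (proj1 (KL_basis_unique hiota char0 hKL _ _ _)).
- by rewrite /d mem_below_bound.
- move=> z zw; rewrite /d; case: (boolP (z \in _)) => [zb|_]; last by rewrite size_poly0.
  by rewrite size_poly1 uphalf_gt0 subn_gt0 ell_below_codominant.
- by rewrite -DE bar_below_bound.
Qed.

(** The coefficients of D (1 + T_i) are constant along pairs z, z s_i; for an
ascent z they are the sum of the indicator of z and of q times that of z s_i.
The term q occurs only when z s_i, which has a descent, is bounded, and then
the hypothesis leaves room for degree 1. *)
Theorem KL_codominant_mul_simple i w : codominant w -> ~~ descent i w ->
    (forall z, z \in below (bound w) -> descent i z -> (ell z + 2 <= ell w)%N) ->
  let A z := (z \in below (bound w))%:R : {poly int} in
  let w' := (t_ i * w)%g in
  v ^+ ell w' *: C' w' = below_sum F (bound w) * (1 + Tg i) /\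
  forall z, ~~ descent i z ->
    A z + 'X * A (t_ i * z)%g = if bruhat z w' then P z w' else 0.
Proof.
move=> cod asc short A w'.
pose d z : {poly int} := if descent i z then A (t_ i * z)%g + 'X * A z
  else A z + 'X * A (t_ i * z)%g.
have coefA z : T_coef z (below_sum F (bound w)) = eval_q F (A z).
  rewrite T_coef_sum big_mkcond (bigD1 z) //= big1 => [|u uz].
    by rewrite addr0 T_coef_T eqxx /A; case: ifP => _; rewrite ?eval_q1 ?eval_q0.
  by rewrite T_coef_T eq_sym (negPf uz) if_same.
have DE : below_sum F (bound w) * (1 + Tg i) = \sum_z eval_q F (d z) *: T z.
  rewrite [LHS]T_span; apply: eq_bigr => z _; congr (_ *: _).
  rewrite mulrDr mulr1 T_coefD T_coef_T_gen !coefA /d.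
  case: ifP => _; rewrite eval_qD eval_qM eval_qX //.
  by rewrite mulrBl mul1r addrCA [X in _ + X]addrC subrK.
have w'b : w' \notin below (bound w).
  by apply/negP=> /short; rewrite descentM asc ell_ascent // => /(_ isT); lia.
have size_d z : ~~ descent i z -> z != w ->
    (size (A z + 'X * A (t_ i * z)%g)%R <= uphalf (ell w - ell z))%N.
  move=> asc_z zw.
  rewrite /A; case: (boolP (t_ i * z \in _)%g) => [szb|_].
    have := short _ szb; rewrite descentM asc_z ell_ascent // => /(_ isT) lz.
    apply: (@leq_trans 2); last by lia.
    by case: (z \in _); rewrite mulr1 ?add0r ?size_polyX // addrC size_XaddC.
  rewrite mulr0 addr0; case: (boolP (z \in _)) => [zb|_]; last by rewrite size_poly0.
  by rewrite size_poly1 uphalf_gt0 subn_gt0 ell_below_codominant.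
have [|||-> dP] := @KL_basis_unique F n iota hiota char0 C' P hKL w' d.
- by rewrite /d descentM asc /= simple_transpK /A mem_below_bound (negPf w'b) mulr0 addr0.
- move=> z zw'; rewrite /d /w' ell_ascent //.
  case: (boolP (descent i z)) => [des|asc_z].
    have asc_sz : ~~ descent i (t_ i * z)%g by rewrite descentM negbK.
    rewrite (ell_descent des) subSS; have := size_d _ asc_sz; rewrite simple_transpK.
    by apply; apply: contraNneq zw' => szw; rewrite /w' -szw simple_transpK.
  have [->|zw] := eqVneq z w.
    by rewrite -/w' /A mem_below_bound (negPf w'b) mulr0 addr0 size_poly1 subSnn.
  by rewrite (leq_trans (size_d _ asc_z zw)) // uphalf_leq // leq_sub2r.
- rewrite -DE rmorphM /= bar_below_bound // (bar_1T hiota) -scalerAl -scalerAr scalerA.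
  by rewrite /w' ell_ascent // exprS [(q * _)^-1]invfM mulrC.
- rewrite -DE; split=> // z asc_z.
  by rewrite -dP /d (negPf asc_z).
Qed.
End CodominantKL.

(** * The characters of the symmetric group at (n) and (n-1,1) *)

Section SubmoduleTrace.
Variables (F : fieldType) (gT : finGroupType) (G : {group gT}) (N : nat).
Variables (rG : mx_representation F G N) (U : 'M[F]_N) (Umod : mxmodule rG U).

(** The representation on U is written in the basis row_base U, which is not
explicit; the trace may be taken in any other basis. *)
Lemma mxtrace_submod_basis d (B : 'M[F]_(d, N)) (M : 'M[F]_d) g :
  row_free B -> (B :=: U)%MS -> B *m rG g = M *m B ->
  \tr (submod_repr Umod g) = \tr M.
Proof.
move=> freeB eqBU BgE.
have /submxP[X XE] : (row_base U <= B)%MS by rewrite eqBU eq_row_base.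
have /submxP[Y YE] : (B <= row_base U)%MS by rewrite eq_row_base eqBU.
have YX : Y *m X = 1%:M.
  by apply: (row_free_inj freeB); rewrite -mulmxA -XE -YE mul1mx.
have RK : row_base U *m in_submod U 1%:M = 1%:M.
  rewrite -in_submodE -[row_base U]mul1mx; exact: val_submodK.
have -> : submod_repr Umod g = X *m M *m Y.
  have RgE : row_base U *m rG g = X *m M *m Y *m row_base U.
    by rewrite -(mulmxA (X *m M)) -YE {1}XE -mulmxA BgE mulmxA.
  by rewrite /= /submod_mx /val_submod /= mul1mx RgE in_submodE -(mulmxA (X *m M *m Y)) RK mulmx1.
by rewrite -mulmxA mxtrace_mulC -mulmxA YX mulmx1.
Qed.
End SubmoduleTrace.

Section SpechtCharacters.
Variable F : fieldType.

Section Regular.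
Variable n : nat.
Local Notation G := [set: 'S_n]%G.
Local Notation rG := (regular_repr F G).

Lemma young_symmetrizerE (l : intpart n) k :
  young_symmetrizer F l 0 k = \sum_(g in row_stab l) \sum_(h in col_stab l)
    (-1) ^+ odd_perm h * (enum_val k == g * h)%g%:R.
Proof.
rewrite /young_symmetrizer summxE; apply: eq_bigr => g _.
rewrite summxE; apply: eq_bigr => h _; rewrite !mxE /=; congr (_ * _%:R).
rewrite gring_indexK ?inE // mul1g /=.
by rewrite -(inj_eq enum_val_inj) gring_indexK ?inE.
Qed.

Lemma mul_regular (f : 'S_n -> F) g :
  (\row_(k < #|G|) f (enum_val k)) *m rG g = \row_k f (enum_val k * g^-1)%g.
Proof.
apply/rowP=> k; rewrite !mxE (bigD1 (gring_index G (enum_val k * g^-1)%g)) //=.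
rewrite !mxE gring_indexK ?inE // mulgKV gring_valK !eqxx mulr1 big1 ?addr0 // => k' ne.
rewrite !mxE eqxx /=; case: eqP => [kE|]; last by rewrite mulr0.
by case/eqP: ne; rewrite kE gring_indexK ?inE // mulgK gring_valK.
Qed.
End Regular.

(** The Young symmetrizer is the sum of all group elements. *)
Lemma Sn_char_row n (l : intpart n.+1) w : parts l = n.+1 :: nseq n 0%N ->
  Sn_char F l w = 1.
Proof.
move=> lE.
have row0 (a : 'I_n.+1) : row_of l a = 0%N.
  by rewrite /row_of lE /reshape_index /= subSS subn_eq0 leq_ord.
have colE (a : 'I_n.+1) : col_of l a = a.
  by rewrite /col_of /reshape_offset -/(row_of l a) row0 take0 subn0.
have cE : young_symmetrizer F l = \row_(k < #|[set: 'S_n.+1]|) 1.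
  apply/rowP=> k; rewrite young_symmetrizerE mxE.
  rewrite (eq_bigr (fun g => (enum_val k == g)%:R)) => [|g _].
    rewrite (bigD1 (enum_val k)) ?inE /=; last by apply/forallP=> a; rewrite !row0.
    rewrite eqxx big1 ?addr0 // => g /andP[_ /negPf]; by rewrite eq_sym => ->.
  rewrite (big_pred1 1%g) ?odd_perm1 ?expr0 ?mul1r ?mulg1 // => h.
  rewrite inE; apply/forallP/eqP=> [hcol|-> a]; last by rewrite perm1.
  by apply/permP=> a; apply/val_inj; have /eqP := hcol a; rewrite !colE perm1.
pose B := young_symmetrizer F l.
have Bg g : B *m regular_repr F [set: 'S_n.+1]%G g = 1%:M *m B.
  by rewrite mul1mx /B cE (mul_regular (fun=> 1)).
rewrite /Sn_char (@mxtrace_submod_basis _ _ _ _ _ _ _ 1 B 1%:M) ?mxtrace1 //.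
- rewrite /row_free rank_rV; case: (B =P 0) => // B0.
  have /eqP := congr1 (fun A : 'rV_#|[set: 'S_n.+1]| => A 0 (gring_index [set: 'S_n.+1]%G 1%g)) B0.
  by rewrite /B cE !mxE oner_eq0.
- apply/eqmxP; rewrite cyclic_mx_id cyclic_mx_sub ?submx_refl //.
  by apply/mxmoduleP=> g _; rewrite Bg submxMl.
Qed.

(** Let e_j be the sum of the permutations that map the last point to j.  The
Young symmetrizer is e_last - e_0, its translates are the differences of two
e_j, and e_j g = e_(g j).  So the module is the sum-zero part of the permutation
module. *)
Lemma Sn_char_hook n (l : intpart n.+2) w : parts l = n.+1 :: 1%N :: nseq n 0%N ->
  Sn_char F l w = #|[set a | w a == a]|%:R - 1.
Proof.
move=> lE; pose G := [set: 'S_n.+2]%G; pose rG := regular_repr F G.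
have ltn_max (a : 'I_n.+2) : (a != ord_max) = (a < n.+1)%N.
  by rewrite -val_eqE /= ltn_neqAle leq_ord andbT.
have row_E (a : 'I_n.+2) : row_of l a = (a == ord_max) :> nat.
  rewrite /row_of lE /reshape_index /= subSS subn_eq0 -[(a == _)]negbK ltn_max -leqNgt.
  case: (leqP n.+1 a) => an.
    have -> : nat_of_ord a = n.+1 by apply/eqP; rewrite eqn_leq an leq_ord.
    by rewrite ltnn subSnn.
  by rewrite -ltnS an.
have col_E (a : 'I_n.+2) : col_of l a = (if a == ord_max then 0 else a)%N.
  rewrite /col_of /reshape_offset -/(row_of l a) row_E lE.
  by case: eqP => [->|_]; rewrite /= ?subn0 ?addn0 ?subnn.
have max0 : ord_max != ord0 :> 'I_n.+2 by [].
pose e j : 'rV[F]_#|G| := \row_(k < #|G|) ((enum_val k : 'S_n.+2) ord_max == j)%:R.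
have eM j g : e j *m rG g = e (g j).
  rewrite /e (mul_regular (fun z : 'S_n.+2 => (z ord_max == j)%:R)).
  by apply/rowP=> k; rewrite !mxE permM (canF_eq (permKV g)).
have row_stabE g : (g \in row_stab l) = (g ord_max == ord_max).
  rewrite inE; apply/forallP/eqP=> [/(_ ord_max)|gmax a].
    by rewrite !row_E eqxx; case: (g ord_max =P ord_max).
  rewrite !row_E; have -> // : (g a == ord_max) = (a == ord_max).
  by rewrite -[X in _ == X]gmax (inj_eq perm_inj).
have col_stabE : col_stab l = [set 1%g; tperm ord0 ord_max].
  apply/setP=> g; rewrite !inE; apply/forallP/orP=> [gcol|].
    have fix_mid a : a != ord0 -> a != ord_max -> g a = a.
      move=> a0 am; have /eqP := gcol a; rewrite !col_E (negPf am).
      case: eqP => [_ ea|_ /ord_inj //].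
      by move: a0; rewrite -val_eqE /= -ea.
    have [g0|g0] := eqVneq (g ord0) ord0.
      left; apply/eqP/permP=> a; rewrite perm1.
      have [->|a0] := eqVneq a ord0; first by [].
      have [->|am] := eqVneq a ord_max; last exact: fix_mid.
      have [//|gm] := eqVneq (g ord_max) ord_max.
      have gm0 : g ord_max != ord0 by rewrite -[X in _ != X]g0 (inj_eq perm_inj).
      by have /perm_inj em := fix_mid _ gm0 gm; rewrite em eqxx in gm.
    have g0m : g ord0 = ord_max.
      apply/eqP/negPn/negP=> gm.
      by have /perm_inj e0 := fix_mid _ g0 gm; rewrite e0 eqxx in g0.
    right; apply/eqP/permP=> a; case: tpermP => [->//|->|/eqP a0 /eqP am]; last exact: fix_mid.
    apply/eqP/negPn/negP=> gm0.
    have gmm : g ord_max != ord_max by rewrite -[X in _ != X]g0m (inj_eq perm_inj).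
    by have /perm_inj em := fix_mid _ gm0 gmm; rewrite em eqxx in gmm.
  case=> /eqP-> a; first by rewrite perm1.
  by case: tpermP => [->|->|//]; rewrite !col_E eqxx ?(negPf max0) ?[ord0 == _]eq_sym ?(negPf max0).
have cE : young_symmetrizer F l = e ord_max - e ord0.
  apply/rowP=> k; rewrite young_symmetrizerE !mxE.
  set y := enum_val k; have neT : 1%g != tperm ord0 ord_max :> 'S_n.+2.
    by apply/eqP=> /permP/(_ ord0); rewrite perm1 tpermL => /eqP; rewrite eq_sym (negPf max0).
  have colsum g : \sum_(h in col_stab l) (-1) ^+ odd_perm h * (y == g * h)%g%:R
      = (g == y)%:R - (g == y * tperm ord0 ord_max)%g%:R :> F.
    rewrite col_stabE big_setU1 ?inE //= big_set1 odd_perm1 odd_tperm [ord0 == _]eq_sym max0.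
    rewrite expr0 expr1 mul1r mulN1r mulg1 [y == g]eq_sym; congr (_ - _%:R).
    by rewrite eq_sym -(inj_eq (mulIg (tperm ord0 ord_max))) -mulgA tperm2 mulg1.
  have sum_eq (x : 'S_n.+2) : \sum_(g in row_stab l) (g == x)%:R = (x \in row_stab l)%:R :> F.
    rewrite big_mkcond (bigD1 x) //= eqxx big1 ?addr0 => [|g /negPf->]; last by rewrite if_same.
    by case: ifP.
  rewrite (eq_bigr _ (fun g _ => colsum g)) sumrB !sum_eq !row_stabE permM.
  by rewrite (canF_eq (tpermK _ _)) tpermR.
pose f a := e a - e ord_max.
pose inj : 'I_n.+1 -> 'I_n.+2 := widen_ord (leqnSn _).
have inj_max i : (ord_max == inj i) = false by rewrite -val_eqE /= gtn_eqF.
(* The rows e_i - e_last form a basis, in which g has the matrix M g. *)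
pose B : 'M[F]_(n.+1, #|G|) := \matrix_i f (inj i).
pose M g : 'M[F]_n.+1 := \matrix_(i, j) ((g (inj i) == inj j)%:R - (g ord_max == inj j)%:R).
have rowB i : row i B = f (inj i) by rewrite rowK.
have expand x : \sum_j (x == inj j)%:R *: f (inj j) = f x.
  have [->|xm] := eqVneq x ord_max.
    by rewrite /f subrr big1 // => j _; rewrite inj_max scale0r.
  have [j ->] : exists j, x = inj j.
    by rewrite ltn_max in xm; exists (Ordinal xm); apply/val_inj.
  rewrite (bigD1 j) //= eqxx scale1r big1 ?addr0 // => i ij.
  by rewrite -val_eqE /= eq_sym val_eqE (negPf ij) scale0r.
have Bg g : B *m rG g = M g *m B.
  apply/row_matrixP=> i; rewrite !row_mul rowB mulmxBl !eM.
  rewrite [in RHS]mulmx_sum_row; under [RHS]eq_bigr do rewrite !mxE rowB scalerBl.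
  by rewrite sumrB !expand /f opprB addrA subrK.
have BE : (B :=: cyclic_mx rG (young_symmetrizer F l))%MS.
  apply/eqmxP; rewrite cE andbC cyclic_mx_sub /=; last first.
  - have -> : e ord_max - e ord0 = - row ord0 B.
      by rewrite rowB opprB; congr (_ - e _); apply/val_inj.
    by rewrite eqmx_opp row_sub.
  - by apply/mxmoduleP=> g _; rewrite Bg submxMl.
  apply/row_subP=> i; rewrite rowB.
  pose x := tperm ord0 (inj i).
  have -> : f (inj i) = - ((e ord_max - e ord0) *m rG x).
    by rewrite mulmxBl !eM tpermL tpermD ?opprB // eq_sym ?inj_max // (negPf max0).
  rewrite eqmx_opp; have /mxmoduleP := cyclic_mx_module rG (e ord_max - e ord0).
  move=> /(_ x (in_setT _)); apply: submx_trans; apply: submxMr; exact: cyclic_mx_id.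
have freeB : row_free B.
  apply/row_freeP; pose Z : 'M[F]_(#|G|, n.+1) :=
    \matrix_(k, j) (k == gring_index G (tperm ord_max (inj j)))%:R.
  exists Z; apply/matrixP=> i j; rewrite !mxE.
  rewrite (bigD1 (gring_index G (tperm ord_max (inj j)))) //= !mxE eqxx mulr1.
  rewrite big1 ?addr0 => [|k /negPf nk]; last by rewrite !mxE nk mulr0.
  rewrite gring_indexK ?inE // tpermL [inj j == ord_max]eq_sym inj_max subr0.
  by rewrite -val_eqE /= val_eqE eq_sym.
rewrite /Sn_char (mxtrace_submod_basis _ freeB BE (Bg w)) /mxtrace.
under eq_bigr do rewrite mxE; rewrite sumrB.
have -> : #|[set a | w a == a]|%:R = \sum_a (w a == a)%:R :> F.
  by rewrite -sum1_card natr_sum big_mkcond /=; apply: eq_bigr => a _; rewrite inE; case: (_ == _).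
have one : \sum_a (w ord_max == a)%:R = 1 :> F.
  by rewrite (bigD1 (w ord_max)) //= eqxx big1 ?addr0 // => a /negPf; rewrite eq_sym => ->.
rewrite -[X in _ = _ - X]one [in RHS]big_ord_recr [X in _ = _ - X]big_ord_recr /=.
by rewrite opprD addrACA subrr addr0.
Qed.
End SpechtCharacters.

(** * Specialization at q = 1 and the index character *)

Section Specialization.
Variable F : fieldType.
Local Notation K := (ratfun F).
Local Notation q := (qpar F).
Local Notation v := (vpar F).
Implicit Types (f g : K) (c d : F).

Lemma specializes_inj f c d : specializes f c -> specializes f d -> c = d.
Proof.
move=> [p [r [r1 fE ->]]] [p' [r' [r1' fE' ->]]].
have nz (s : {poly F}) : s.[1] != 0 -> tofrac s != 0 :> K.
  by rewrite tofrac_eq0; apply: contraNneq => ->; rewrite horner0.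
move/eqP: fE'; rewrite fE eqr_div ?nz // -!tofracM tofrac_eq => /eqP/(congr1 (horner^~ 1)) /=.
by rewrite !hornerM => e; apply/eqP; rewrite eqr_div // e.
Qed.

Lemma specializes_tofrac (p : {poly F}) : specializes (tofrac p : K) p.[1].
Proof.
by exists p, 1; split; rewrite ?hornerC ?oner_eq0 ?tofrac1 ?divr1.
Qed.

Lemma specializesD f g c d :
  specializes f c -> specializes g d -> specializes (f + g) (c + d).
Proof.
move=> [p [r [r1 -> ->]]] [p' [r' [r1' -> ->]]].
have nz (s : {poly F}) : s.[1] != 0 -> tofrac s != 0 :> K.
  by rewrite tofrac_eq0; apply: contraNneq => ->; rewrite horner0.
exists (p * r' + p' * r), (r * r'); split; first by rewrite hornerM mulf_neq0.
  by rewrite addf_div ?nz // tofracD !tofracM.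
by rewrite addf_div // hornerD !hornerM.
Qed.

Lemma specializesM f g c d :
  specializes f c -> specializes g d -> specializes (f * g) (c * d).
Proof.
move=> [p [r [r1 -> ->]]] [p' [r' [r1' -> ->]]].
exists (p * p'), (r * r'); split; first by rewrite hornerM mulf_neq0.
  by rewrite mulf_div !tofracM.
by rewrite mulf_div !hornerM.
Qed.

Lemma specializes_sum (I : Type) (s : seq I) (A : pred I) (f : I -> K) (c : I -> F) :
    (forall i, A i -> specializes (f i) (c i)) ->
  specializes (\sum_(i <- s | A i) f i) (\sum_(i <- s | A i) c i).
Proof.
move=> spec; apply: (big_rec2 (fun x y => specializes x y)) => [|i x y Ai].
  by have := specializes_tofrac 0; rewrite tofrac0 horner0.
by apply: specializesD; apply: spec.
Qed.

Lemma specializes_q : specializes q 1.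
Proof.
have := specializes_tofrac ('X ^+ 2); rewrite hornerXn expr1n; congr specializes.
by rewrite /qpar /vpar tofracXn.
Qed.

Lemma specializes_nat m : specializes (m%:R : K) m%:R.
Proof.
have := specializes_tofrac m%:R; rewrite hornerMn hornerC; congr specializes.
by rewrite tofracMn tofrac1.
Qed.

Lemma specializes_vVX m : specializes (v ^- m) 1.
Proof.
exists 1, ('X ^+ m); split; first by rewrite hornerXn expr1n oner_eq0.
  by rewrite tofrac1 div1r /vpar tofracXn.
by rewrite hornerXn expr1n hornerC divr1.
Qed.

End Specialization.

Section HeckeCharacters.
Variables (F : fieldType) (n : nat).
Implicit Types (i j : 'I_n.-1) (w z : 'S_n).
Local Notation t_ := (@simple_transp n).
Local Notation H := (hecke F n).
Local Notation K := (ratfun F).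
Local Notation q := (qpar F).
Local Notation v := (vpar F).
Local Notation Tg := (@T_gen F n).
Local Notation T := (@T_ F n).

Section Character.
Variables (l : intpart n) (chi : H -> K).
Hypothesis hchi : hecke_char l chi.

Lemma hecke_charD : {morph chi : a b / a + b}.
Proof. by have [[d [rho [_ tr]]] _] := hchi => a b; rewrite !tr rmorphD linearD. Qed.

Lemma hecke_charZ c a : chi (c *: a) = c * chi a.
Proof. by have [[d [rho [_ tr]]] _] := hchi; rewrite !tr linearZ /= linearZ. Qed.

Lemma hecke_char_sum (I : Type) (s : seq I) (A : pred I) (f : I -> H) :
  chi (\sum_(i <- s | A i) f i) = \sum_(i <- s | A i) chi (f i).
Proof.
apply: (big_morph _ hecke_charD).
by rewrite -[0](scale0r 0) hecke_charZ mul0r.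
Qed.

Lemma specializes_T w : specializes (chi (T w)) (Sn_char F l w).
Proof. by have [_ spec] := hchi. Qed.

Lemma specializes_below h :
  specializes (chi (below_sum F h)) (\sum_(z in below h) Sn_char F l z).
Proof.
by rewrite hecke_char_sum; apply: specializes_sum => z _; apply: specializes_T.
Qed.

(** Both cases of the multiplication rule become z s_i at q = 1. *)
Lemma specializes_T_gen z i : specializes (chi (T z * Tg i)) (Sn_char F l (t_ i * z)%g).
Proof.
case: (boolP (descent i z)) => [des|asc]; last first.
  by rewrite T_ascent //; apply: specializes_T.
rewrite T_descent // hecke_charD !hecke_charZ.
rewrite -[Sn_char F l (t_ i * z)%g]mul1r -[X in specializes _ X]add0r.
apply: specializesD; last by apply: specializesM; [apply: specializes_q|apply: specializes_T].
rewrite -[0](mul0r (Sn_char F l z)); apply: specializesM; last exact: specializes_T.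
rewrite -[0](subrr 1); apply: specializesD; first exact: specializes_q.
by have := specializes_tofrac (-1 : {poly F}); rewrite tofracN tofrac1 hornerN hornerC.
Qed.

Lemma specializes_below_mul h i :
  specializes (chi (below_sum F h * (1 + Tg i)))
    (\sum_(z in below h) (Sn_char F l z + Sn_char F l (t_ i * z)%g)).
Proof.
rewrite mulr_suml hecke_char_sum; apply: specializes_sum => z _.
rewrite mulrDr mulr1 hecke_charD; apply: specializesD; first exact: specializes_T.
exact: specializes_T_gen.
Qed.

Lemma specializes_unscale m a c : specializes (chi (v ^+ m *: a)) c -> specializes (chi a) c.
Proof.
rewrite hecke_charZ => spec; have := specializesM (specializes_vVX F m) spec.
by rewrite mulKf ?expf_neq0 ?vpar_neq0 // mul1r.
Qed.

Hypothesis char0 : [pchar F] =i pred0.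

(** The value at 1 specializes to 1, so the representation has dimension 1.
Then T_i acts by a root of x^2 = (q - 1) x + q, that is by q or -1, and -1 does
not specialize to 1. *)
Lemma index_char : (forall w, Sn_char F l w = 1) -> forall w, chi (T w) = q ^+ ell w.
Proof.
move=> triv; have [[d [rho [_ tr]]] _] := hchi.
have nat0 m : (m%:R == 0 :> F) = (m == 0%N) by have /pcharf0P -> := char0.
have d0 : d = 0%N.
  have := specializes_T 1%g; rewrite triv T1 tr rmorph1 mxtrace1 => spec.
  have /eqP := specializes_inj (specializes_nat F d.+1) spec.
  by rewrite -subr_eq0 -[1]/(1%:R) -natrB // subn1 nat0 => /eqP.
subst d.
have chiM a b : chi (a * b) = chi a * chi b.
  rewrite !tr rmorphM /= /mxtrace !big_ord1 mxE big_ord1.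
  by rewrite !ord1.
have chi1 : chi 1 = 1 by rewrite tr rmorph1 mxtrace1.
have chiTg i : chi (Tg i) = q.
  have : (chi (Tg i) - q) * (chi (Tg i) + 1) == 0.
    have := congr1 chi (T_gen_sq F i); rewrite chiM hecke_charD !hecke_charZ chi1 mulr1 => e.
    have factor (L : comNzRingType) (x a : L) : (x - a) * (x + 1) = x * x - ((a - 1) * x + a).
      by ring.
    by rewrite factor e subrr.
  rewrite mulf_eq0 subr_eq0 => /orP[/eqP//|]; rewrite addr_eq0 => /eqP m1.
  have := specializes_T (t_ i); rewrite triv T_simple m1 => spec.
  have := specializes_tofrac (-1 : {poly F}); rewrite tofracN tofrac1 hornerN hornerC => spec'.
  have /eqP := specializes_inj spec spec'; rewrite -subr_eq0 opprK.
  by rewrite -[1 + 1]/(2%:R) nat0.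
move=> w; have [s red_s <-] := reduced_word_ex w; rewrite T_wordE //.
elim/last_ind: s red_s => [|s i IH]; first by rewrite /T_word big_nil chi1 ell1.
rewrite reduced_rcons => /andP[red_s asc].
by rewrite T_word_rcons chiM IH // chiTg word_perm_rcons ell_ascent // exprSr.
Qed.
End Character.
End HeckeCharacters.

(** * Coefficients of Schur polynomials *)

Section Partitions.
Variable n : nat.
Implicit Types l : intpart n.

Definition part l i : nat := nth 0%N (parts l) i.

Lemma size_parts l : size (parts l) = n.
Proof. by rewrite /parts size_map size_tuple. Qed.

Lemma part_le l i j : (i <= j)%N -> (part l j <= part l i)%N.
Proof.
move=> ij; have [jn|jn] := ltnP j n; last by rewrite /part (nth_default _ _) ?size_parts.
have /andP[srt _] := valP l.
apply: (@sorted_leq_nth _ geq) => //; rewrite ?inE ?size_parts //.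
  by move=> a b c ab bc; apply: leq_trans bc ab.
- by move=> a; apply: leqnn.
- exact: leq_ltn_trans ij jn.
Qed.

Lemma sum_parts l : (\sum_(i < n) part l i = n)%N.
Proof.
have /andP[_ /eqP sum_l] := valP l.
by rewrite -[RHS]sum_l -/(parts l) sumnE (big_nth 0%N) size_parts big_mkord.
Qed.

Lemma part_inj l l' : (forall i, part l i = part l' i) -> l = l'.
Proof.
move=> eq_part; apply/val_inj/val_inj/(inj_map val_inj).
by apply: (@eq_from_nth _ 0%N) => [|i _]; [rewrite !size_map !size_tuple|apply: eq_part].
Qed.

Lemma part_lt l i j : (j < part l i)%N -> (i < n)%N /\ (j < n)%N.
Proof.
move=> jl; have i_n : (i < n)%N.
  by rewrite ltnNge; apply: contraTN jl => ni; rewrite /part nth_default ?size_parts.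
split=> //; apply: leq_trans jl _.
by rewrite -[leqRHS](sum_parts l) (bigD1 (Ordinal i_n)) //= leq_addr.
Qed.

Lemma cell_ex l i j : (j < part l i)%N ->
  exists c : cell l, cell_row c = i /\ cell_col c = j.
Proof.
move=> jl; have [i_n j_n] := part_lt jl.
by exists (exist _ (Ordinal i_n, Ordinal j_n) jl).
Qed.

End Partitions.

Lemma part_single_row n (l : intpart n.+1) : part l 1 = 0%N ->
  parts l = n.+1 :: nseq n 0%N.
Proof.
move=> l1; have l0 i : (0 < i)%N -> part l i = 0%N.
  by move=> i0; apply/eqP; rewrite -leqn0 -l1 part_le.
apply: (@eq_from_nth _ 0%N); rewrite ?size_parts /= ?size_nseq // => -[|i] ilt.
  have := sum_parts l; rewrite big_ord_recl big1 ?addn0 // => i _; exact: l0.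
by rewrite -/(part l i.+1) l0 //= nth_nseq if_same.
Qed.

Lemma part_hook n (l : intpart n.+2) : part l 1 = 1%N -> part l 2 = 0%N ->
  parts l = n.+1 :: 1%N :: nseq n 0%N.
Proof.
move=> l1 l2; have l0 i : (1 < i)%N -> part l i = 0%N.
  by move=> i0; apply/eqP; rewrite -leqn0 -l2 part_le.
apply: (@eq_from_nth _ 0%N); rewrite ?size_parts /= ?size_nseq // => -[|[|i]] ilt //.
  have := sum_parts l; rewrite !big_ord_recl big1 => [|i _]; last exact: l0.
  by rewrite /bump /= l1 addn0 addn1 => -[].
by rewrite -/(part l i.+2) l0 //= nth_nseq if_same.
Qed.

Section Tableaux.
Variables (n : nat) (l : intpart n) (m : nat) (t : {ffun cell l -> 'I_m}).
Hypothesis ssyt : is_ssyt t.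

Lemma ssyt_column (c d : cell l) :
  cell_col c = cell_col d -> (cell_row c < cell_row d)%N -> (t c < t d)%N.
Proof.
move=> ecol lrow; have := ssyt; rewrite /is_ssyt => /forallP/(_ c)/forallP/(_ d)/andP[_].
by rewrite ecol eqxx lrow.
Qed.

End Tableaux.

Section Schur.
Variables (K : fieldType) (n : nat).

(** The exponent of the monomial of a tableau. *)
Definition weight (l : intpart n) m (t : {ffun cell l -> 'I_m}) : 'X_{1..m} :=
  (\sum_(c : cell l) U_(t c))%MM.

Lemma weightE (l : intpart n) m (t : {ffun cell l -> 'I_m}) j :
  weight t j = #|[set c | t c == j]|.
Proof.
rewrite /weight mnm_sumE -sum1_card [RHS]big_mkcond /=.
by apply: eq_bigr => c _; rewrite mnm1E inE; case: eqP.
Qed.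

Lemma mcoeff_schur (l : intpart n) m (mu : 'X_{1..m}) :
  (schur K l m)@_mu = #|[set t : {ffun cell l -> 'I_m} | is_ssyt t & weight t == mu]|%:R.
Proof.
rewrite /schur raddf_sum /= -sum1_card natr_sum big_mkcond [RHS]big_mkcond /=.
apply: eq_bigr => t _; rewrite inE; case: (is_ssyt t) => //=.
have -> : \prod_(c : cell l) 'X_(t c) = 'X_[weight t] :> {mpoly K[m]}.
  by rewrite /weight (big_morph _ (@mpolyXD _ _) (@mpolyX0 _ _)).
by rewrite mcoeffX; case: eqP.
Qed.

Lemma mcoeff_combination (D : intpart n -> K) m (mu : 'X_{1..m}) :
  \sum_l D l *: schur K l m = 0 -> \sum_l D l * (schur K l m)@_mu = 0.
Proof.
move=> /(congr1 (mcoeff mu)); rewrite raddf_sum mcoeff0 /= => E; rewrite -[RHS]E.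
by apply: eq_bigr => l _; rewrite mcoeffZ.
Qed.

End Schur.

Section SchurCoefficients.
Variables (K : fieldType) (n : nat) (D : intpart n.+2 -> K).
Hypothesis char0 : [pchar K] =i pred0.
Hypothesis D0 : forall m, \sum_l D l *: schur K l m = 0.

Lemma natr_neq0 k : (0 < k)%N -> k%:R != 0 :> K.
Proof. by have /pcharf0P -> := char0; rewrite lt0n. Qed.

(** In one variable, a shape with at least two rows has no semistandard
tableau. *)
Lemma schur_coef_row l : parts l = n.+2 :: nseq n.+1 0%N -> D l = 0.
Proof.
move=> lE; pose t : {ffun cell l -> 'I_1} := [ffun=> ord0].
have := mcoeff_combination (weight t) (D0 1).
rewrite (bigD1 l) //= big1 ?addr0 => [/eqP|l' ne].
  rewrite mulf_eq0 => /orP[/eqP//|]; rewrite mcoeff_schur; apply: contraTeq => _.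
  apply: natr_neq0; apply/card_gt0P; exists t; rewrite inE eqxx andbT.
  apply/forallP=> c; apply/forallP=> d; rewrite !ffunE leqnn implybT /=.
  have row0 (x : cell l) : cell_row x = 0%N.
    case: x => -[x y] /= xy; rewrite /cell_row /=; move: xy; rewrite lE.
    case: (nat_of_ord x) => // x'.
    by rewrite -[nth _ _ _]/(nth 0%N (nseq n.+1 0%N) x') nth_nseq if_same.
  by rewrite !row0 ltnn andbF.
have part1 : (0 < part l' 1)%N.
  rewrite lt0n; apply: contra ne => /eqP/part_single_row l'E.
  by apply/eqP/part_inj => i; rewrite /part lE l'E.
rewrite mcoeff_schur (_ : [set _ | _ & _] = set0) ?cards0 ?mulr0 //.
apply/setP=> t'; rewrite !inE; apply/negP=> /andP[ss _].
have [c [c_row c_col]] := cell_ex (leq_trans part1 (part_le l' (leq0n 1))).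
have [d [d_row d_col]] := cell_ex part1.
have := ssyt_column ss (etrans c_col (esym d_col)).
by rewrite c_row d_row !ord1 => /(_ isT).
Qed.

(** In two variables, tableaux with a single entry 1 and all other entries 0
exist for the shapes (n) and (n-1,1) only: three rows do not fit two values, and
a second row of length at least 2 needs two entries 1.  The coefficient of (n)
vanishes already. *)
Lemma schur_coef_hook l : parts l = n.+1 :: 1%N :: nseq n 0%N -> D l = 0.
Proof.
move=> lE; pose one : 'I_2 := lift ord0 ord0.
pose t : {ffun cell l -> 'I_2} := [ffun c => if cell_row c == 0%N then ord0 else one].
have cell_lower (c : cell l) : cell_row c != 0%N -> cell_row c = 1%N /\ cell_col c = 0%N.
  case: c => -[x y] /= xy; rewrite /cell_row /cell_col /=; move: xy; rewrite lE /=.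
  case: (nat_of_ord x) => [|[|x']] //=; first by rewrite ltnS leqn0 => /eqP.
  by rewrite nth_nseq if_same.
have l1 : part l 1 = 1%N by rewrite /part lE.
have ss_t : is_ssyt t.
  apply/forallP=> c; apply/forallP=> d; rewrite !ffunE; apply/andP; split.
    by apply/implyP=> /andP[/eqP-> _]; apply: leqnn.
  apply/implyP=> /andP[_ lt_cd].
  have d0 : cell_row d != 0%N by rewrite -lt0n (leq_ltn_trans _ lt_cd).
  have [d1 _] := cell_lower _ d0; rewrite d1 /=.
  by move: lt_cd; rewrite d1 ltnS leqn0 => ->.
have w1 : weight t one = 1%N.
  have [c [c_row c_col]] := cell_ex (leq_trans (leqnn 1) (eq_leq (esym l1))).
  rewrite weightE (_ : [set _ | _] = [set c]) ?cards1 //.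
  apply/setP=> d; rewrite !inE ffunE; case: (cell_row d =P 0%N) => [d0|/eqP d0].
    by rewrite -[ord0 == one]/false; apply/esym/negbTE/eqP=> dc; rewrite dc c_row in d0.
  rewrite eqxx; symmetry; apply/eqP; apply: val_inj.
  have [d1 dc] := cell_lower _ d0.
  move: c_row c_col d1 dc; rewrite /cell_row /cell_col => cr cc dr dc.
  apply/eqP; rewrite [val c]surjective_pairing [val d]surjective_pairing xpair_eqE.
  by rewrite -!val_eqE /= cr cc dr dc !eqxx.
have := mcoeff_combination (weight t) (D0 2).
rewrite (bigD1 l) //= big1 ?addr0 => [/eqP|l' ne].
  rewrite mulf_eq0 => /orP[/eqP//|]; rewrite mcoeff_schur; apply: contraTeq => _.
  by apply: natr_neq0; apply/card_gt0P; exists t; rewrite inE eqxx andbT.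
have [/part_single_row/schur_coef_row->|part1] := eqVneq (part l' 1) 0%N.
  by rewrite mul0r.
rewrite -lt0n in part1.
rewrite mcoeff_schur (_ : [set _ | _ & _] = set0) ?cards0 ?mulr0 //.
apply/setP=> t'; rewrite !inE; apply/negP=> /andP[ss /eqP wt].
have [c [c_row c_col]] := cell_ex (leq_trans part1 (part_le l' (leq0n 1))).
have [d [d_row d_col]] := cell_ex part1.
have cd : (t' c < t' d)%N.
  by apply: (ssyt_column ss (etrans c_col (esym d_col))); rewrite c_row d_row.
have [part2|part2] := posnP (part l' 2); last first.
  have [f [f_row f_col]] := cell_ex part2.
  have df : (t' d < t' f)%N.
    by apply: (ssyt_column ss (etrans d_col (esym f_col))); rewrite d_row f_row.
  by have := ltn_ord (t' f); lia.
have part1' : (1 < part l' 1)%N.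
  rewrite ltn_neqAle part1 andbT eq_sym; apply: contra ne => /eqP l'1.
  apply/eqP/part_inj => i; rewrite /part lE (part_hook l'1 part2).
  by [].
have [c' [c'_row c'_col]] := cell_ex (leq_trans part1' (part_le l' (leq0n 1))).
have [d' [d'_row d'_col]] := cell_ex part1'.
have cd' : (t' c' < t' d')%N.
  by apply: (ssyt_column ss (etrans c'_col (esym d'_col))); rewrite c'_row d'_row.
have is_one u : (0 < t' u)%N -> t' u = one.
  move=> u0; apply/val_inj; rewrite -[val one]/1%N.
  by apply/eqP; rewrite eqn_leq u0 -ltnS ltn_ord.
have : ([set d; d'] \subset [set u | t' u == one]).
  by apply/subsetP=> u /set2P[]->; rewrite inE is_one //; lia.
move/subset_leq_card; rewrite -weightE wt w1 cards2.
have -> // : d != d'.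
by apply/eqP=> e; rewrite e d'_col in d_col.
Qed.
End SchurCoefficients.

(** * Counting bounded permutations *)

Section Counting.

Lemma lift_perm_surj n (a b : 'I_n.+1) (z : 'S_n.+1) :
  z a = b -> exists s, z = lift_perm a b s.
Proof.
move=> zab; pose u k := odflt k (unlift b (z (lift a k))).
have uK k : lift b (u k) = z (lift a k).
  rewrite /u; have : b != z (lift a k) by rewrite -zab (inj_eq perm_inj) neq_lift.
  by case/unlift_some=> ? ? ->.
have u_inj : injective u.
  by move=> k k' /(congr1 (lift b)); rewrite !uK => /perm_inj/lift_inj.
exists (perm u_inj); apply/permP=> k.
case: (unliftP a k) => [k' ->|->]; last by rewrite lift_perm_id.
by rewrite lift_perm_lift permE uK.
Qed.

Lemma lift_perm_inj n (a b : 'I_n.+1) : injective (@lift_perm n a b).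
Proof.
move=> s s' e; apply/permP=> k; apply: (@lift_inj _ b).
by rewrite -!(lift_perm_lift a) e.
Qed.

(** Deleting row a and column b of the permutation matrix lowers by one the
bounds that exceed b. *)
Lemma card_below_at n (h : 'I_n.+1 -> nat) (a b : 'I_n.+1) : (b < h a)%N ->
  #|[set z in below h | z a == b]|
    = #|below (fun j : 'I_n => (h (lift a j) - (b < h (lift a j)))%N)|.
Proof.
move=> bh; rewrite -(card_imset _ (@lift_perm_inj n a b)); apply: eq_card => z.
have shift (H k : nat) : (bump b k < H)%N = (k < H - (b < H))%N.
  by rewrite /bump; lia.
apply/idP/imsetP=> [|[s /belowP sh ->]].
  rewrite inE => /andP[/belowP zh /eqP zab].
  have [s zs] := lift_perm_surj zab; exists s => //.
  apply/belowP=> j; rewrite -shift.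
  by have := zh (lift a j); rewrite zs lift_perm_lift.
rewrite inE lift_perm_id eqxx andbT; apply/belowP=> k.
case: (unliftP a k) => [k' ->|->]; last by rewrite lift_perm_id.
by rewrite lift_perm_lift /= shift.
Qed.

(** For every value of z(0) below h(0), the remaining bounds are lowered by one,
because they are at least h(0). *)
Lemma card_below n (h : 'I_n -> nat) :
    (forall a b : 'I_n, (a <= b)%N -> (h a <= h b)%N) -> (forall a, (h a <= n)%N) ->
  #|below h| = (\prod_(a < n) (h a - a))%N.
Proof.
elim: n h => [|n IH] h mono bnd.
  rewrite big_ord0; have -> : below h = [set: 'S_0].
    by apply/setP=> z; rewrite !inE; apply/forallP=> -[].
  by rewrite cardsT card_Sn.
pose h' (j : 'I_n) := (h (lift ord0 j) - 1)%N.
have cardE (b : 'I_n.+1) : (b < h ord0)%N ->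
    #|[set z in below h | z ord0 == b]| = (\prod_(j < n) (h' j - j))%N.
  move=> bh; rewrite card_below_at // -IH.
  - have e j : (h (lift ord0 j) - (b < h (lift ord0 j)))%N = h' j.
      by rewrite /h' (leq_trans bh) ?mono.
    by apply: eq_card => z; apply/belowP/belowP=> zb j; have := zb j; rewrite e.
  - by move=> j k jk; rewrite leq_sub2r // mono //= /bump /= leq_add2l.
  - by move=> j; rewrite /h'; have := bnd (lift ord0 j); lia.
rewrite -sum1_card.
rewrite (partition_big (fun z : 'S_n.+1 => z ord0) (fun b => b < h ord0)%N) /=; last first.
  by move=> z /belowP.
rewrite (eq_bigr (fun=> (\prod_(j < n) (h' j - j))%N)) => [|b bh]; last first.
  by rewrite sum1_card -(cardE b bh); apply: eq_card => z; rewrite inE.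
rewrite -(big_ord_widen n.+1 (fun=> (\prod_(j < n) (h' j - j))%N) (bnd ord0)).
rewrite sum_nat_const card_ord big_ord_recl subn0; congr (_ * _)%N.
by apply: eq_bigr => j _; rewrite /h' /= /bump /=; lia.
Qed.

(** With i = 0 and the values of h as s this is the product of the
h(a) - a. *)
Fixpoint staircase i (s : seq nat) : nat :=
  if s is x :: s' then ((x - i) * staircase i.+1 s')%N else 1%N.

(** For the list s of the values of h, the number of bounded permutations that
map a to b ([card_below_place]). *)
Definition place a b (s : seq nat) : nat :=
  if (b < nth 0%N s a)%N
  then staircase 0 [seq (x - (b < x))%N | x <- take a s ++ drop a.+1 s] else 0%N.

Definition bounds n (h : 'I_n -> nat) : seq nat := [seq h a | a <- enum 'I_n].

Lemma size_bounds n (h : 'I_n -> nat) : size (bounds h) = n.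
Proof. by rewrite size_map size_enum_ord. Qed.

Lemma nth_bounds n (h : 'I_n -> nat) (a : 'I_n) : nth 0%N (bounds h) a = h a.
Proof. by rewrite (nth_map a) ?size_enum_ord // nth_ord_enum. Qed.

Lemma staircaseE n (h : 'I_n -> nat) : staircase 0 (bounds h) = (\prod_(a < n) (h a - a))%N.
Proof.
have gen i s : staircase i s = (\prod_(j < size s) (nth 0%N s j - (i + j)))%N.
  elim: s i => [|x s IH] i; first by rewrite big_ord0.
  rewrite /= big_ord_recl addn0 IH; congr (_ * _)%N.
  by apply: eq_bigr => j _; rewrite /= /bump /= addSnnS.
rewrite gen size_bounds; apply: eq_bigr => a _; by rewrite nth_bounds.
Qed.

Lemma bounds_lift n (h : 'I_n.+1 -> nat) (a : 'I_n.+1) (f : nat -> nat) :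
  bounds (fun j : 'I_n => f (h (lift a j)))
    = [seq f x | x <- take a (bounds h) ++ drop a.+1 (bounds h)].
Proof.
have an : (a < size (bounds h))%N by rewrite size_bounds.
have szd : size (take a (bounds h) ++ drop a.+1 (bounds h)) = n.
  by rewrite size_cat size_take size_drop an size_bounds; have := ltn_ord a; lia.
apply: (@eq_from_nth _ 0%N); rewrite size_bounds ?size_map ?szd // => j jn.
rewrite (nth_map 0%N) ?szd // -[j]/(nat_of_ord (Ordinal jn)) nth_bounds -nth_bounds.
congr f; rewrite nth_cat size_take an /= /bump.
case: (ltnP j a) => ja; first by rewrite nth_take // add0n.
by rewrite nth_drop add1n; congr nth; lia.
Qed.

Lemma card_below_place n (h : 'I_n.+1 -> nat) (a b : 'I_n.+1) :
    (forall a b : 'I_n.+1, (a <= b)%N -> (h a <= h b)%N) -> (forall a, (h a <= n.+1)%N) ->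
  #|[set z in below h | z a == b]| = place a b (bounds h).
Proof.
move=> mono bnd; rewrite /place nth_bounds; case: ltnP => [bh|hb].
  rewrite card_below_at // card_below.
  - by rewrite -staircaseE (bounds_lift h a (fun x => x - (b < x))%N).
  - move=> j k jk; have := mono (lift a j) (lift a k).
    by rewrite /= leq_bump2 => /(_ jk); lia.
  - move=> j; have := bnd (lift a j); have := ltn_ord b.
    by case: (ltnP b (h (lift a j))); lia.
apply: eq_card0 => z; rewrite inE; apply/negP=> /andP[/belowP/(_ a) + /eqP zab].
by rewrite zab ltnNge hb.
Qed.

End Counting.

(** * Search through the possible bounds *)

Section Enumeration.

(** The weakly increasing lists of k entries between lo and m whose entry at
position j exceeds m - k + j.  For k = m these are the possible running
maxima. *)
Fixpoint bound_lists (m k lo : nat) : seq (seq nat) :=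
  if k is k'.+1 then
    flatten [seq [seq x :: s | s <- bound_lists m k' x]
            | x <- iota lo (m.+1 - lo) & (m - k' <= x)%N]
  else [:: [::]].

Lemma mem_bound_lists m k lo s : size s = k -> path leq lo s ->
  (forall j, (j < k)%N -> (m + j < nth 0%N s j + k <= m + k)%N) -> s \in bound_lists m k lo.
Proof.
elim: k lo s => [|k IH] lo [|x s] //= [sz] /andP[lox px] bnd.
have := bnd 0%N isT; rewrite /= addn0 => x_bnd.
apply/flattenP; exists [seq x :: s | s <- bound_lists m k x].
  by apply: map_f; rewrite mem_filter mem_iota; lia.
by apply: map_f; apply: IH => // j jk; have := bnd j.+1 jk; rewrite /=; lia.
Qed.

Lemma bounds_bound_listed n (w : 'S_n) : bounds (bound w) \in bound_lists n n 0.
Proof.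
apply: mem_bound_lists; first exact: size_bounds.
  rewrite path_min_sorted; last by apply/allP.
  apply/(sortedP 0%N) => j; rewrite size_bounds => jn.
  rewrite -[j.+1]/(nat_of_ord (Ordinal jn)) -[j]/(nat_of_ord (Ordinal (ltnW jn))) !nth_bounds.
  exact: bound_mono.
move=> j jn; rewrite -[j]/(nat_of_ord (Ordinal jn)) nth_bounds /=.
have := bound_le w (Ordinal jn).
have := code_below (@bound_mono n w) (@bound_le n w) (mem_below_bound w) (Ordinal jn).
by rewrite /=; lia.
Qed.

(** The number of fixed points of all the bounded permutations together
([fixsumE]). *)
Definition fixsum (s : seq nat) : nat := sumn [seq place a a s | a <- iota 0 (size s)].

(** Binary numbers keep the search feasible by plain reduction. *)
Fixpoint staircaseN i (s : seq nat) : BinNums.N :=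
  if s is x :: s' then BinNat.N.mul (BinNat.N.of_nat (x - i)) (staircaseN i.+1 s')
  else BinNat.N.one.

Definition placeN a (s : seq nat) : BinNums.N :=
  if (a < nth 0%N s a)%N
  then staircaseN 0 [seq (x - (a < x))%N | x <- take a s ++ drop a.+1 s] else BinNat.N.zero.

Definition fixsumN (s : seq nat) : BinNums.N :=
  foldr BinNat.N.add BinNat.N.zero [seq placeN a s | a <- iota 0 (size s)].

Lemma staircaseNE i s : staircaseN i s = BinNat.N.of_nat (staircase i s).
Proof. by elim: s i => //= x s IH i; rewrite IH -Nnat.Nat2N.inj_mul. Qed.

Lemma fixsumNE s : fixsumN s = BinNat.N.of_nat (fixsum s).
Proof.
rewrite /fixsumN /fixsum; elim: (iota _ _) => //= a r ->.
rewrite Nnat.Nat2N.inj_add; congr BinNat.N.add.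
by rewrite /placeN /place; case: ifP => // _; rewrite staircaseNE.
Qed.

(** The tables are built once, outside of the double loop. *)
Definition has_pair (L : seq (seq nat)) (m : nat) (c f : BinNums.N) : bool :=
  let counts s := (staircaseN 0 s, fixsumN s) in
  let table := [seq counts s | s <- L] in
  let table_m := [seq counts s | s <- L & sumn s == m] in
  has (fun x => has (fun y =>
    BinNat.N.eqb (BinNat.N.add x.1 y.1) c && BinNat.N.eqb (BinNat.N.add x.2 y.2) f) table) table_m.

Lemma has_pairP L m c f s t : s \in L -> t \in L -> sumn s = m ->
    (staircase 0 s + staircase 0 t)%N = c -> (fixsum s + fixsum t)%N = f ->
  has_pair L m (BinNat.N.of_nat c) (BinNat.N.of_nat f).
Proof.
move=> sL tL s_m cnt fixs; apply/hasP; exists (staircaseN 0 s, fixsumN s).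
  by apply: (map_f (fun s => (staircaseN 0 s, fixsumN s))); rewrite mem_filter s_m eqxx.
apply/hasP; exists (staircaseN 0 t, fixsumN t).
  exact: (map_f (fun s => (staircaseN 0 s, fixsumN s))).
rewrite /= !staircaseNE !fixsumNE -!Nnat.Nat2N.inj_add.
by rewrite -[Nat.add _ _]/(_ + _)%N cnt -[Nat.add _ _]/(_ + _)%N fixs !BinNat.N.eqb_refl.
Qed.

(** A permutation of length 17 has running maxima with sum 17 + 36 = 53. *)
Lemma no_pair_of_bounds :
  has_pair (bound_lists 8 8 0) 53 (BinNat.N.of_nat 4800) (BinNat.N.of_nat 8832) = false.
Proof. by vm_compute. Qed.
End Enumeration.

(** * Comparison of lowest terms *)

Section LowestTerms.
Variable F : fieldType.
Hypothesis char0 : [pchar F] =i pred0.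

(** If the larger one of l0 and l2 is not m, then the term of lowest degree
on one side is not matched on the other side; when l0 = l2, the right side has
lowest coefficient 2. *)
Lemma lowest_terms (m l0 l2 : nat) (b a0 a2 : {poly F}) :
    b`_0 = 1 -> a0`_0 = 1 -> a2`_0 = 1 ->
    'X^(l0 + l2) * b = 'X^(m + l2) * a0 + 'X^(m + l0) * a2 ->
  l0 = m \/ l2 = m.
Proof.
wlog le02 : l0 l2 a0 a2 / (l0 <= l2)%N => [gen b1 a01 a21 E|b1 a01 a21 E].
  have [le02|le20] := leqP l0 l2; first exact: (gen l0 l2 a0 a2).
  have [|||||->|->] := gen l2 l0 a2 a0 => //; [exact: ltnW| |by right|by left].
  by rewrite addnC E addrC.
right; have coefE k := congr1 (fun p : {poly F} => p`_k) E.
case: (ltngtP l2 m) => // lm.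
  have := coefE (l0 + l2)%N; rewrite coefD !coefXnM ltnn subnn b1.
  have -> : (l0 + l2 < m + l2)%N by lia.
  have -> : (l0 + l2 < m + l0)%N by lia.
  by rewrite addr0 => /eqP; rewrite oner_eq0.
have := coefE (m + l0)%N; rewrite coefD !coefXnM ltnn subnn a21.
have -> : (m + l0 < l0 + l2)%N by lia.
case: ltnP => [_|le20] /esym/eqP; first by rewrite add0r oner_eq0.
have -> : (m + l0 - (m + l2) = 0)%N by lia.
by rewrite a01 -[1 + 1]/(2%:R); have /pcharf0P -> := char0.
Qed.
End LowestTerms.

Section IndexPolynomial.
Variables (F : fieldType) (n : nat) (l : intpart n) (chi : hecke F n -> ratfun F).
Hypothesis hchi : hecke_char l chi.
Hypothesis index : forall w : 'S_n, chi (T_ F w) = qpar F ^+ ell w.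

(** The Poincare polynomial of A, in the variable v = q^(1/2). *)
Definition length_poly (A : {set 'S_n}) : {poly F} := \sum_(z in A) 'X^(2 * ell z).

Lemma length_poly_coef0 (A : {set 'S_n}) : 1%g \in A -> (length_poly A)`_0 = 1.
Proof.
move=> A1; rewrite coef_sum (bigD1 1%g) //= ell1 coefXn eqxx big1 ?addr0 // => z /andP[_ z1].
rewrite coefXn; case: eqP => // /esym/eqP; rewrite muln_eq0 /= => lz.
case/eqP: z1; apply: no_descent_perm1 => i; apply/negP=> /ell_descent; lia.
Qed.

Lemma index_below h : chi (below_sum F h) = tofrac (length_poly (below h)).
Proof.
rewrite (hecke_char_sum hchi) rmorph_sum /=; apply: eq_bigr => z _.
by rewrite index tofracXn exprM.
Qed.

Lemma index_below_mul h i :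
  chi (below_sum F h * (1 + @T_gen F n i)) = tofrac ((1 + 'X^2) * length_poly (below h)).
Proof.
rewrite rmorphM /= rmorphD rmorph1 rmorphXn /= -index_below.
rewrite (hecke_char_sum hchi) mulr_suml (hecke_char_sum hchi) mulr_sumr.
apply: eq_bigr => z _; rewrite mulrDr mulr1 (hecke_charD hchi) mulrDl mul1r; congr (_ + _).
case: (boolP (descent i z)) => [des|asc]; last by rewrite T_ascent // !index ell_ascent // exprS.
rewrite T_descent // (hecke_charD hchi) !(hecke_charZ hchi) !index (ell_descent des).
by rewrite -exprS mulrBl mul1r subrK.
Qed.

End IndexPolynomial.

(** * Fixed points and one-line notation *)

Section FixedPoints.
Variable n : nat.

Definition fixed_points (z : 'S_n) : nat := #|[set a | z a == a]|.

Lemma sum_fixed_points (A : {set 'S_n}) (f : 'S_n -> 'S_n) :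
  (\sum_(z in A) fixed_points (f z) = \sum_a #|[set z in A | f z a == a]|)%N.
Proof.
have -> : (\sum_(z in A) fixed_points (f z) = \sum_(z in A) \sum_a (f z a == a : nat))%N.
  apply: eq_bigr => z _; rewrite /fixed_points -sum1_card [LHS]big_mkcond.
  by apply: eq_bigr => a _; rewrite inE; case: eqP.
rewrite exchange_big /=; apply: eq_bigr => a _.
rewrite -sum1_card big_mkcond [RHS]big_mkcond /=; apply: eq_bigr => z _.
by rewrite !inE; case: (z \in A); case: eqP.
Qed.

End FixedPoints.

Lemma fixsumE n (h : 'I_n.+1 -> nat) :
    (forall a b : 'I_n.+1, (a <= b)%N -> (h a <= h b)%N) -> (forall a, (h a <= n.+1)%N) ->
  (\sum_(z in below h) fixed_points z)%N = fixsum (bounds h).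
Proof.
move=> mono bnd; rewrite (sum_fixed_points _ id) /fixsum size_bounds sumnE big_map.
rewrite -[iota 0 n.+1]val_enum_ord big_map big_enum /=.
by apply: eq_bigr => a _; rewrite (card_below_place _ _ mono bnd).
Qed.

Section OneLine.
Variable n : nat.
Implicit Types w : 'S_n.

Lemma one_lineE w (a : 'I_n) : (w a).+1 = nth 0%N (one_line w) a.
Proof. by rewrite /one_line (nth_map a) ?size_enum_ord // nth_ord_enum. Qed.

Lemma boundE w (a : 'I_n) :
  bound w a = foldr maxn 0%N [seq nth 0%N (one_line w) b | b <- iota 0 n & (b <= a)%N].
Proof.
rewrite foldrE big_map big_filter -val_enum_ord big_map big_enum_cond /=.
by apply: eq_big => // b _; rewrite one_lineE.
Qed.

Lemma codominant_one_line w :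
    all (fun i => all (fun j => all (fun k =>
      let x := nth 0%N (one_line w) in
      ~~ [&& (i < j)%N, (j < k)%N, (x j < x k)%N & (x k < x i)%N])
      (iota 0 n)) (iota 0 n)) (iota 0 n) ->
  codominant w.
Proof.
move=> chk; apply/forallP=> i; apply/forallP=> j; apply/forallP=> k.
have mem (a : 'I_n) : (a : nat) \in iota 0 n by rewrite mem_iota /= ltn_ord.
have := allP (allP (allP chk _ (mem i)) _ (mem j)) _ (mem k).
by rewrite /= -!one_lineE !ltnS.
Qed.

End OneLine.

Lemma intpart_ex n (s : seq nat) :
  size s = n -> sorted geq s -> sumn s = n -> exists l : intpart n, parts l = s.
Proof.
move=> sz srt sm; have sz' : size [seq inord x : 'I_n.+1 | x <- s] == n by rewrite size_map sz.
have valE : [seq val x | x <- [seq inord x : 'I_n.+1 | x <- s]] = s.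
  rewrite -map_comp -[RHS]map_id; apply/eq_in_map => x xs /=; apply: inordK.
  rewrite ltnS -sm; elim: s xs {sz srt sm sz'} => //= y s IH; rewrite inE.
  by case/orP=> [/eqP->|/IH]; rewrite ?leq_addr // => /leq_trans; apply; rewrite leq_addl.
have ok : is_intpart (Tuple sz') by rewrite /is_intpart /= valE srt sm eqxx.
by exists (exist _ (Tuple sz') ok); rewrite /parts /= valE.
Qed.

(** * The permutation 62754381 *)

Lemma ratfun_char0 (F : fieldType) : [pchar F] =i pred0 -> [pchar (ratfun F)] =i pred0.
Proof.
move=> char0; apply/pcharf0P=> m; rewrite -[m%:R](rmorph_nat (@tofrac {poly F})).
have /pcharf0P <- := char0.
by rewrite tofrac_eq0 -[m%:R in LHS]polyC_natr polyC_eq0.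
Qed.

Lemma clear_denominators (L : fieldType) (u b a c : L) m l k : u != 0 ->
    u ^- m * b = u ^- l * a + u ^- k * c ->
  u ^+ (l + k) * b = u ^+ (m + k) * a + u ^+ (m + l) * c.
Proof.
move=> u0 E; have nz j : u ^+ j != 0 by rewrite expf_neq0.
have -> : b = u ^+ m * (u ^- l * a + u ^- k * c) by rewrite -E mulVKf.
by rewrite !exprD; field; rewrite !nz.
Qed.

Lemma sumn_bounds n (h : 'I_n -> nat) : sumn (bounds h) = (\sum_a h a)%N.
Proof. by rewrite sumnE big_map big_enum. Qed.

Section Example.
Variable w : 'S_8.
Hypothesis hw : one_line w = [:: 6; 2; 7; 5; 4; 3; 8; 1]%N.
Let i0 : 'I_8.-1 := ord0.
Let t := simple_transp i0.
(* The permutation 26754381. *)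
Let w1 := (t * w)%g.
Let L1 := [:: 2; 6; 7; 7; 7; 7; 8; 8]%N.

(* The transposition of the first two positions, as a list of values. *)
Let swap01 : seq nat := [:: 1; 0; 2; 3; 4; 5; 6; 7]%N.

Lemma swap01E (a : 'I_8) : nat_of_ord (t a) = nth 0%N swap01 a.
Proof.
rewrite /t simple_transpE; case: tpermP => [->|->|] //.
by case: a => -[|[|[|[|[|[|[|[|]]]]]]]] //= a8 ne1 ne2; [case: ne1|case: ne2]; apply/val_inj.
Qed.

Lemma one_line_w1 : one_line w1 = [:: 2; 6; 7; 5; 4; 3; 8; 1]%N.
Proof.
apply: (@eq_from_nth _ 0%N); rewrite size_map size_enum_ord // => j j8.
rewrite -[j]/(nat_of_ord (Ordinal j8)) -one_lineE permM one_lineE hw swap01E /=.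
by case: j j8 => [|[|[|[|[|[|[|[|]]]]]]]].
Qed.

Lemma codominant_w1 : codominant w1.
Proof. by apply: codominant_one_line; rewrite one_line_w1. Qed.

Lemma bounds_w1 : bounds (bound w1) = L1.
Proof.
rewrite /bounds; under eq_map do rewrite boundE one_line_w1.
rewrite (map_comp (fun a => foldr maxn 0%N [seq _ | b <- iota 0 8 & (b <= a)%N]) val).
by rewrite val_enum_ord.
Qed.

Lemma bound_w1 (a : 'I_8) : bound w1 a = nth 0%N L1 a.
Proof. by rewrite -bounds_w1 nth_bounds. Qed.

Lemma sum_succ8 : (\sum_(a < 8) a.+1 = 36)%N.
Proof. by rewrite !big_ord_recl big_ord0. Qed.

Lemma ell_w1 : ell w1 = 16%N.
Proof.
by have := ell_codominant codominant_w1; rewrite sum_succ8 -sumn_bounds bounds_w1 /=; lia.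
Qed.

Lemma ascent_w1 : ~~ descent i0 w1.
Proof.
have := one_lineE w1 (lo i0); have := one_lineE w1 (hi i0).
by rewrite one_line_w1 /descent /=; lia.
Qed.

(** A bounded z with a descent at the first position starts with the values 1
and 0, so its code vanishes at the second position, where that of w1 is 4. *)
Lemma short_w1 z : z \in below (bound w1) -> descent i0 z -> (ell z + 2 <= ell w1)%N.
Proof.
move=> zb; have := belowP _ _ zb (lo i0); rewrite bound_w1 /= /descent => z_lo des.
have le_code a : (code z a <= code w1 a)%N.
  rewrite -(leq_add2r a.+1) (code_codominant _ codominant_w1).
  exact: (code_below (@bound_mono _ w1) (@bound_le _ w1) zb).
have code_hi : code z (hi i0) = 0%N.
  by apply: eq_card0 => b; rewrite !inE; lia.
have code_hi1 : code w1 (hi i0) = 4%N.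
  by have := code_codominant (hi i0) codominant_w1; rewrite bound_w1 /=; lia.
rewrite !ell_code (bigD1 (hi i0)) //= [in leqRHS](bigD1 (hi i0)) //= code_hi code_hi1.
by rewrite add0n addnC leq_add // leq_sum.
Qed.

Lemma mem_below_1 : 1%g \in below (bound w1).
Proof.
apply/belowP=> a; rewrite perm1.
by have := code_below (@bound_mono _ w1) (@bound_le _ w1) (mem_below_bound w1) a; lia.
Qed.

Lemma mem_below_t : t \in below (bound w1).
Proof.
apply/belowP=> a; rewrite bound_w1 swap01E.
by case: a => -[|[|[|[|[|[|[|[|]]]]]]]].
Qed.

Lemma card_below_w1 : #|below (bound w1)| = 2400%N.
Proof.
rewrite card_below; [|exact: bound_mono|exact: bound_le].
by rewrite -staircaseE bounds_w1.
Qed.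

(** By the formula [card_below_place], where for t * z the condition
z(t(a)) = a replaces z(a) = a. *)
Lemma fixed_points_w1 :
  (\sum_(z in below (bound w1)) (fixed_points z + fixed_points (t * z)%g) = 8832)%N.
Proof.
rewrite big_split /= fixsumE ?bounds_w1; [|exact: bound_mono|exact: bound_le].
rewrite (sum_fixed_points _ (mulg t)).
have -> : (\sum_a #|[set z in below (bound w1) | (t * z)%g a == a]|
   = sumn [seq place (nth 0 swap01 a) a L1 | a <- iota 0 8])%N.
  rewrite sumnE big_map -[iota 0 8]val_enum_ord big_map big_enum /=.
  apply: eq_bigr => a _; rewrite -swap01E -bounds_w1 -card_below_place;
    [|exact: bound_mono|exact: bound_le].
  by apply: eq_card => z; rewrite !inE permM.
by vm_compute.
Qed.

End Example.

Section Contradiction.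
Variables (F : fieldType) (iota : {rmorphism hecke F 8 -> hecke F 8}).
Hypothesis char0 : [pchar F] =i pred0.
Hypothesis hiota : bar_involution iota.
Variables (C' : 'S_8 -> hecke F 8) (P : 'S_8 -> 'S_8 -> {poly int}).
Hypothesis hKL : KL_basis iota C' P.
Variable w : 'S_8.
Hypothesis hw : one_line w = [:: 6; 2; 7; 5; 4; 3; 8; 1]%N.
Let i0 : 'I_8.-1 := ord0.
Let t := simple_transp i0.
Let h1 := bound (t * w)%g.

Lemma KL_element_w : vpar F ^+ 17 *: C' w = below_sum F h1 * (1 + @T_gen F 8 i0).
Proof.
have [+ _] := KL_codominant_mul_simple char0 hiota hKL
  (codominant_w1 hw) (ascent_w1 hw) (short_w1 hw).
by rewrite (ell_ascent (ascent_w1 hw)) (ell_w1 hw) simple_transpK.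
Qed.

Lemma KL_polynomial_1w : P 1%g w = 1 + 'X.
Proof.
have [_ Pz] := KL_codominant_mul_simple char0 hiota hKL
  (codominant_w1 hw) (ascent_w1 hw) (short_w1 hw).
have asc1 : ~~ descent i0 1%g by rewrite /descent !perm1.
have := Pz 1%g asc1; rewrite mulg1 mem_below_1 (mem_below_t hw) simple_transpK mulr1.
case: ifP => [_ -> //|_ /(congr1 (fun p : {poly int} => p`_0)) /eqP].
by rewrite coefD coefX coefC coef0.
Qed.

Section Equality.
Variable chi : intpart 8 -> hecke F 8 -> ratfun F.
Hypothesis hchi : forall l, hecke_char l (chi l).
Variables (w0 w2 : 'S_8).
Hypothesis cod0 : codominant w0.
Hypothesis cod2 : codominant w2.

Section OneCharacter.
Variable l : intpart 8.
Hypothesis chi_eq : chi l (C' w) = chi l (C' w0) + chi l (C' w2).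

(** The equation of characters at q = 1, where all powers of v become 1. *)
Lemma Sn_char_eq :
  \sum_(z in below h1) (Sn_char F l z + Sn_char F l (t * z)%g)
    = \sum_(z in below (bound w0)) Sn_char F l z + \sum_(z in below (bound w2)) Sn_char F l z.
Proof.
have spec u : codominant u ->
      specializes (chi l (C' u)) (\sum_(z in below (bound u)) Sn_char F l z).
  move=> cod; apply: (specializes_unscale (hchi l) (m := ell u)).
  rewrite (KL_codominant char0 hiota hKL cod); exact: specializes_below.
apply: (specializes_inj (f := chi l (C' w))).
  apply: (specializes_unscale (hchi l) (m := 17)).
  rewrite KL_element_w; exact: specializes_below_mul.
by rewrite chi_eq; apply: specializesD; apply: spec.
Qed.

Hypothesis index : forall z, Sn_char F l z = 1.

(** The index character turns the three elements into Laurent polynomials in v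
with lowest terms v^-17, v^-l(w0) and v^-l(w2). *)
Lemma ell_eq_17 : ell w0 = 17%N \/ ell w2 = 17%N.
Proof.
have idx := index_char (hchi l) char0 index.
have CE u m x : vpar F ^+ m *: C' u = x -> chi l (C' u) = vpar F ^- m * chi l x.
  by move=> <-; rewrite (hecke_charZ (hchi l)) mulKf // expf_neq0 // vpar_neq0.
have := chi_eq; rewrite (CE _ _ _ KL_element_w).
rewrite (CE _ _ _ (KL_codominant char0 hiota hKL cod0)).
rewrite (CE _ _ _ (KL_codominant char0 hiota hKL cod2)).
rewrite (index_below_mul (hchi l) idx) !(index_below (hchi l) idx).
move=> /(clear_denominators (vpar_neq0 F)).
rewrite -!tofracXn -!tofracM -tofracD => /eqP; rewrite tofrac_eq => /eqP.
have len1 u : codominant u -> (length_poly F (below (bound u)))`_0 = 1.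
  move=> cod; apply: length_poly_coef0; apply/belowP=> a; rewrite perm1.
  by have := code_codominant a cod; lia.
apply: (lowest_terms char0); rewrite ?len1 //.
rewrite mulrDl mul1r coefD coefXnM addr0 len1 //; exact: codominant_w1.
Qed.
End OneCharacter.

(** The first character counts permutations, and its sum with the second one
counts fixed points. *)
Lemma not_all_equal (l l' : intpart 8) :
    (forall z, Sn_char F l z = 1) ->
    (forall z, Sn_char F l' z = (fixed_points z)%:R - 1) ->
    chi l (C' w) = chi l (C' w0) + chi l (C' w2) ->
    chi l' (C' w) = chi l' (C' w0) + chi l' (C' w2) -> False.
Proof.
move=> triv hook eq_l eq_l'.
have nat_inj (a b : nat) : a%:R = b%:R :> F -> a = b.
  wlog ab : a b / (a <= b)%N => [gen e|/esym/eqP].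
    by have [ab|/ltnW ba] := leqP a b; [exact: gen|symmetry; apply: gen].
  by rewrite -subr_eq0 -natrB //; have /pcharf0P -> := char0; lia.
have counts : (#|below (bound w0)| + #|below (bound w2)| = 4800)%N.
  apply: nat_inj; have := Sn_char_eq eq_l.
  under eq_bigr do rewrite !triv; under [X in _ = X + _]eq_bigr do rewrite triv.
  under [X in _ = _ + X]eq_bigr do rewrite triv.
  rewrite !sumr_const (card_below_w1 hw) -natrD => <-.
  by rewrite -mulr2n -mulrnA.
have fixes : (\sum_(z in below (bound w0)) fixed_points z
    + \sum_(z in below (bound w2)) fixed_points z = 8832)%N.
  apply: nat_inj; rewrite -(fixed_points_w1 hw) natrD !natr_sum.
  have fixE z : (fixed_points z)%:R = Sn_char F l z + Sn_char F l' z.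
    by rewrite triv hook addrC subrK.
  under eq_bigr do rewrite fixE; under [X in _ + X]eq_bigr do rewrite fixE.
  rewrite !big_split /= addrACA -(Sn_char_eq eq_l) -(Sn_char_eq eq_l') -big_split /=.
  by apply: eq_bigr => z _; rewrite natrD !fixE addrACA.
have fixsumE' (u : 'S_8) :
    (\sum_(z in below (bound u)) fixed_points z)%N = fixsum (bounds (bound u)).
  by apply: fixsumE; [exact: bound_mono|exact: bound_le].
have stairE (u : 'S_8) : #|below (bound u)| = staircase 0 (bounds (bound u)).
  by rewrite staircaseE card_below //; [exact: bound_mono|exact: bound_le].
have sum53 (u : 'S_8) : codominant u -> ell u = 17%N -> sumn (bounds (bound u)) = 53%N.
  by move=> cod lu; rewrite sumn_bounds -(ell_codominant cod) lu sum_succ8.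
move: counts fixes; rewrite !stairE !fixsumE' => counts fixes.
have hl (u : 'S_8) : bounds (bound u) \in bound_lists 8 8 0 := bounds_bound_listed u.
have := no_pair_of_bounds; case: (ell_eq_17 eq_l triv) => lu.
  by rewrite (has_pairP (hl w0) (hl w2) (sum53 _ cod0 lu) counts fixes).
rewrite addnC in counts; rewrite addnC in fixes.
by rewrite (has_pairP (hl w2) (hl w0) (sum53 _ cod2 lu) counts fixes).
Qed.
End Equality.
End Contradiction.

Theorem theorem1p8 (R : realType)
    (iota : {rmorphism hecke R[i] 8 -> hecke R[i] 8})
    (hiota : bar_involution iota)
    (C' : 'S_8 -> hecke R[i] 8) (P : 'S_8 -> 'S_8 -> {poly int})
    (hKL : KL_basis iota C' P)
    (chi : intpart 8 -> hecke R[i] 8 -> ratfun R[i])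
    (hchi : forall l : intpart 8, hecke_char l (chi l))
    (w : 'S_8) (hw : one_line w = [:: 6; 2; 7; 5; 4; 3; 8; 1]%N) :
  P 1%g w = 1 + 'X /\
  ~ (exists w0 w2 : 'S_8,
       [/\ codominant w0, codominant w2
         & forall m : nat,
             ch chi (C' w) m = ch chi (C' w0) m + ch chi (C' w2) m]).
Proof.
have char0 : [pchar R[i]] =i pred0 by exact: Num.Theory.pchar_num.
split; first exact: (KL_polynomial_1w char0 hiota hKL hw).
move=> [w0 [w2 [cod0 cod2 ch_eq]]].
pose D l := chi l (C' w) - (chi l (C' w0) + chi l (C' w2)).
have D0 m : \sum_l D l *: schur (ratfun R[i]) l m = 0.
  under eq_bigr do rewrite scalerBl scalerDl.
  by rewrite sumrB big_split /= -!/(ch chi _ m) ch_eq subrr.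
have [l lE] := @intpart_ex 8 [:: 8; 0; 0; 0; 0; 0; 0; 0]%N erefl erefl erefl.
have [l' l'E] := @intpart_ex 8 [:: 7; 1; 0; 0; 0; 0; 0; 0]%N erefl erefl erefl.
have Kchar0 := ratfun_char0 char0.
apply: (not_all_equal char0 hiota hKL hw hchi cod0 cod2 (l := l) (l' := l')).
- by move=> z; apply: (@Sn_char_row _ 7).
- by move=> z; apply: (@Sn_char_hook _ 6).
- by apply/eqP; rewrite -subr_eq0; apply/eqP; apply: (schur_coef_row Kchar0 D0).
- by apply/eqP; rewrite -subr_eq0; apply/eqP; apply: (schur_coef_hook Kchar0 D0).
Qed.
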